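(* Let $n\geqslant 2$ and let $X_1,\dots,X_n$ be independent real random variables with $\mathbb{E}X_j=0$ and $\mathbb{E}X_j^2=1$. Put $S_n=(X_1+\cdots+X_n)/\sqrt n$ and $S_{n;k}=\frac{1}{\sqrt{n-1}}\sum_{1\leqslant j\leqslant n,\,j\neq k}X_j$. Let $J\subset\mathbb{Z}^+$ be a set of integers such that $\mathbb{E}H_k(X_j)=0$ for all $k\in J$ and all $j=1,\dots,n$. Then \[ \chi^2(S_n,\mathcal N)\leqslant\left(\sum_{j\in\mathbb{Z}^+\setminus J}\frac{1}{n^{j-2}}\right)\frac1n\sum_{k=1}^n\chi^2(X_k,\mathcal N)+\frac{C_J(1/n)}{n}\sum_{k=1}^n\chi^2(X_k,\mathcal N)\,\chi^2(S_{n;k},\mathcal N). \]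
   Context: $\varphi(x)=e^{-x^2/2}/\sqrt{2\pi}$. For a real random variable $Y$ with density $p$, $\chi^2(Y,\mathcal N)=\int_{-\infty}^{\infty}\left(\frac{p(x)}{\varphi(x)}-1\right)^2\varphi(x)\,dx$ (taken to be $+\infty$ if $Y$ has no density). Hermite polynomials $H_n$ are defined by $\sum_{n\geqslant0}\frac{H_n(x)}{n!}z^n=e^{xz-z^2/2}$. $\mathbb{Z}^+$ is the set of positive integers. For $J\subset\mathbb{Z}^+$, $s\in\mathbb{Z}^+$, $0<p<1$: $h_J(s,p)=\frac{(1-p)^s}{p^2}\sum_{k\in\mathbb{Z}^+\setminus J}\frac{k^2}{(k+s)^2}\binom{k+s}{k}p^k$ and $C_J(p)=\max_{s\in\mathbb{Z}^+}h_J(s,p)$. *)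

(* Defs.v *)
From HB Require Import structures.
From mathcomp Require Import all_boot all_order all_algebra.
From mathcomp Require Import all_classical all_reals all_analysis.
Set Implicit Arguments. Unset Strict Implicit. Unset Printing Implicit Defensive.
Import Order.TTheory GRing.Theory Num.Theory.
Import numFieldNormedType.Exports.
Local Open Scope classical_set_scope.
Local Open Scope ring_scope.

Definition gauss_dens (R : realType) (x : R) : R :=
  expR (- (x ^+ 2) / 2) / Num.sqrt (2 * pi).

(* Hermite polynomials, defined through the generating function
   sum_n H_n(x) z^n / n! = exp(x z - z^2/2), i.e.
   H_n(x) = n-th derivative in z at z = 0 of exp(x z - z^2/2). *)
Definition hermite (R : realType) (k : nat) (x : R) : R :=
  derive1n k (fun z : R => expR (x * z - z ^+ 2 / 2)) 0.

Definition is_density d (T : measurableType d) (R : realType)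
  (P : probability T R) (Y : T -> R) (p : R -> R) : Prop :=
  [/\ measurable_fun setT p, (forall x, 0 <= p x) &
      forall A : set R, measurable A ->
        P (Y @^-1` A) = (\int[@lebesgue_measure R]_(x in A) (p x)%:E)%E].

(* chi^2(Y, N) = int (p/phi - 1)^2 phi dx where p is a density of Y,
   and +oo if Y has no density (infimum of the empty set is +oo).
   All densities agree a.e., so the set below is a singleton when
   nonempty. *)
Definition chi2 d (T : measurableType d) (R : realType)
  (P : probability T R) (Y : T -> R) : \bar R :=
  ereal_inf [set v : \bar R | exists p, is_density P Y p /\
     v = (\int[@lebesgue_measure R]_x
            (((p x / gauss_dens x - 1) ^+ 2 * gauss_dens x)%:E))%E].

Definition mutually_independent d (T : measurableType d) (R : realType)
  (P : probability T R) (n : nat) (X : 'I_n -> T -> R) : Prop :=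
  forall A : 'I_n -> set R, (forall j, measurable (A j)) ->
    P [set w | forall j, A j (X j w)] =
    (\big[*%E/1%E]_(j < n) P (X j @^-1` A j))%E.

Definition hJ (R : realType) (J : set nat) (s : nat) (p : R) : \bar R :=
  (((1 - p) ^+ s / p ^+ 2)%:E *
   \sum_(1 <= k <oo | k \notin J)
      (((k ^ 2)%:R / ((k + s) ^ 2)%:R * ('C(k + s, k))%:R * p ^+ k)%:E))%E.

Definition CJ (R : realType) (J : set nat) (p : R) : \bar R :=
  ereal_sup [set hJ J s p | s in [set s : nat | (0 < s)%N]].

(* Main.v *)
Require Import Defs.
From HB Require Import structures.
From mathcomp Require Import all_boot all_order all_algebra.
From mathcomp Require Import all_classical all_reals all_analysis.
From mathcomp Require Import measurable_realfun.
From mathcomp Require Import ring lra.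
Import Order.TTheory GRing.Theory Num.Theory.
Import numFieldNormedType.Exports.
Local Open Scope classical_set_scope.
Local Open Scope ring_scope.

(* Write h_m = H_m / m!, so that sum_m h_m(x) z^m = exp(x z - z^2/2), and
   gauss for the standard Gaussian measure, for which the h_m are orthogonal
   with norm (m!)^(-1/2).  Formally chi^2(Y, N) = sum_(m >= 1) m! (E h_m(Y))^2.

   For c^2 + d^2 = 1 the generating function gives
   h_m(c x + d y) = sum_(j+s=m) c^j d^s h_j(x) h_s(y), and, using the
   three-term recurrence m h_m(S) = S h_(m-1)(S) - h_(m-2)(S),
     m h_m(S_n) = sum_k sum_(j+s=m) j n^(-j/2) (1-1/n)^(s/2) h_j(X_k) h_s(S_(n;k)).
   Taking expectations (X_k and S_(n;k) are independent), the terms with j in J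
   vanish; Cauchy-Schwarz first in k and then in j, followed by summation over
   m, gives the right-hand side.  For X_k and S_(n;k) only Bessel's inequality is
   needed.

   The converse inequality chi^2(S_n, N) <= C := sum_(m >= 1) m! (E h_m(S_n))^2
   includes the existence of a density, and hence (take J = Z^+) the determinacy
   of the Gaussian moment problem.  For a polynomial q, expanding q in the h_m gives
     2 (E q(S_n) - gauss(q)) <= C + gauss(q^2).
   This inequality forces exponential moments of S_n and passes to pointwise
   limits dominated by some exp(c(1+|x|)), and every bounded measurable function
   is obtained from polynomials by such limits.  Testing with multiples of
   indicators yields absolute continuity, and testing with the truncations of
   f - 1, f the density relative to gauss, yields gauss((f-1)^2) <= C. *)

(** * Hermite polynomials *)

Section HermitePolynomials.
Variable R : realType.

Fixpoint hermp (k : nat) : {poly R} :=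
  if k is k'.+1 then 'X * hermp k' - (hermp k')^`() else 1.

Lemma hermpS k : hermp k.+1 = 'X * hermp k - (hermp k)^`().
Proof. by []. Qed.

(** The exponential contributes the factor [x - z] and the inner function [x - z] has derivative
    [-1], so the product rule reproduces the recursion [hermpS] evaluated at [x - z]. *)
Lemma derive1n_hermp k (x : R) :
  derive1n k (fun z : R => expR (x * z - z ^+ 2 / 2)) =
  (fun z => (hermp k).[x - z] * expR (x * z - z ^+ 2 / 2)).
Proof.
elim: k => [|k IH].
  by rewrite derive1n0; apply/funext => z; rewrite /= hornerC mul1r.
rewrite derive1nS IH; apply/funext => z; rewrite derive1E.
have D1 : is_derive z 1 (fun z : R => x - z) (-1).
  by apply: is_derive_eq; rewrite add0r mul1r.
have D2 : is_derive z 1 (fun z : R => (hermp k).[x - z]) (- (hermp k)^`().[x - z]).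
  rewrite -mulrN1.
  exact: (@is_derive1_comp _ (horner (hermp k)) (fun z => x - z)).
have D3 : is_derive z 1 (fun z : R => x * z - z ^+ 2 / 2) (x - z).
  by apply: is_derive_eq; rewrite /GRing.scale /=; lra.
have D4 : is_derive z 1 (fun z : R => expR (x * z - z ^+ 2 / 2))
    ((x - z) * expR (x * z - z ^+ 2 / 2)).
  by rewrite mulrC; apply: (@is_derive1_comp _ expR).
rewrite derive_val /= !hornerE /GRing.scale /=; ring.
Qed.

Lemma hermiteE k (x : R) : hermite k x = (hermp k).[x].
Proof.
by rewrite /hermite derive1n_hermp /= subr0 mulr0 expr0n /= mul0r subr0 expR0 mulr1.
Qed.

(** Appell property; it turns the defining recursion, which contains a derivative, into the
    three-term recurrence [hermpSS]. *)
Lemma deriv_hermp k : (hermp k.+1)^`() = k.+1%:R *: hermp k.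
Proof.
elim: k => [|k IH]; first by rewrite /= mulr1 derivC subr0 derivX scale1r.
rewrite hermpS derivB derivM derivX mul1r IH derivZ.
have -> : hermp k.+1 + 'X * (k.+1%:R *: hermp k) - k.+1%:R *: (hermp k)^`() =
  hermp k.+1 + k.+1%:R *: hermp k.+1 by rewrite hermpS scalerBr -scalerAr -addrA.
by rewrite -[in LHS](scale1r (hermp k.+1)) [X in _ + X]scalerA mulr1 -scalerDl -[1]/(1%:R) -natrD.
Qed.

Lemma hermpSS k : hermp k.+2 = 'X * hermp k.+1 - k.+1%:R *: hermp k.
Proof. by rewrite hermpS deriv_hermp. Qed.

Lemma size_hermp_monic k : (size (hermp k) == k.+1) && (hermp k \is monic).
Proof.
elim: k => [|k /andP[/eqP IHs IHm]]; first by rewrite /= size_poly1 eqxx monic1.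
have sX : size ('X * hermp k) = k.+2.
  by rewrite mulrC size_mulX ?monic_neq0 // IHs.
have sd : (size (- (hermp k)^`())%R < size ('X * hermp k)%R)%N.
  by rewrite sX size_polyN (leq_ltn_trans (size_poly _ _)) // IHs.
rewrite hermpS size_polyDl // sX eqxx /= monicE lead_coefDl // -monicE.
by rewrite monicMr // monicX.
Qed.

Lemma size_hermp k : size (hermp k) = k.+1.
Proof. by case/andP: (size_hermp_monic k) => /eqP. Qed.

Lemma lead_coef_hermp k : lead_coef (hermp k) = 1.
Proof. by case/andP: (size_hermp_monic k) => _ /monicP. Qed.

(** Triangularity: [hermp N] is monic of degree [N], so subtracting the right multiple of it removes
    the coefficient of degree [N] and lowers the size bound by one. *)
Lemma hermp_span N (q : {poly R}) : (size q <= N)%N ->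
  exists c : nat -> R, q = \sum_(i < N) c i *: hermp i.
Proof.
elim: N q => [|N IH] q sq.
  by exists (fun _ => 0); rewrite big_ord0; apply/eqP; rewrite -size_poly_leq0.
have /IH[c Hc] : (size (q - q`_N *: hermp N)%R <= N)%N.
  apply/leq_sizeP => j; rewrite leq_eqVlt => /orP[/eqP <-|Nj].
    have := lead_coef_hermp N; rewrite /lead_coef size_hermp /= => L.
    by rewrite coefB coefZ L mulr1 subrr.
  rewrite coefB coefZ [q`_j]nth_default ?(leq_trans sq) //.
  by rewrite [(hermp N)`_j]nth_default ?size_hermp // mulr0 subrr.
exists (fun i => if i == N then q`_N else c i).
rewrite big_ord_recr /= eqxx -[LHS](subrK (q`_N *: hermp N)) Hc; congr (_ + _).
by apply: eq_bigr => i _; rewrite ltn_eqF.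
Qed.

Definition nherm k : {poly R} := k`!%:R^-1 *: hermp k.

Lemma nherm0 : nherm 0 = 1. Proof. by rewrite /nherm invr1 scale1r. Qed.

Lemma nherm1 : nherm 1 = 'X.
Proof. by rewrite /nherm /= invr1 scale1r mulr1 derivC subr0. Qed.

Lemma hermp_nherm k : hermp k = k`!%:R *: nherm k.
Proof. by rewrite scalerA divff ?scale1r // pnatr_eq0 -lt0n fact_gt0. Qed.

Lemma nhermSS k (x : R) :
  k.+2%:R * (nherm k.+2).[x] = x * (nherm k.+1).[x] - (nherm k).[x].
Proof.
rewrite /nherm hermpSS.
move: (hermp k.+1) (hermp k) => p q; rewrite !(hornerZ, hornerD, hornerN, hornerM, hornerX).
have f0 : k`!%:R != 0 :> R by rewrite pnatr_eq0 -lt0n fact_gt0.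
have k1 : k.+1%:R != 0 :> R by rewrite pnatr_eq0.
have k2 : k.+2%:R != 0 :> R by rewrite pnatr_eq0.
rewrite !factS !natrM; move: f0 k1 k2 (_.[x]) (_.[x]).
move: (k`!%:R : R) (k.+1%:R : R) (k.+2%:R : R) => a b c a0 b0 c0 u v.
by field; rewrite a0 b0 c0.
Qed.

End HermitePolynomials.

Arguments hermp : simpl never.
Arguments nherm : simpl never.

(** * Addition formulas for Hermite polynomials *)

Section HermiteAddition.
Variable R : realType.
Local Notation h := (@nherm R).

(* h_(m-1), with the convention h_(-1) = 0. *)
Definition nherm_pred m (x : R) := if m is m'.+1 then (h m').[x] else 0.

Lemma nherm_rec m (x : R) :
  m.+1%:R * (h m.+1).[x] = x * (h m).[x] - nherm_pred m x.
Proof.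
case: m => [|m]; last exact: nhermSS.
by rewrite nherm1 nherm0 hornerX hornerC mul1r mulr1 subr0.
Qed.

(* For w = 1 and c^2 + d^2 = 1 this is h_m(c x + d y); the weight w j = j selects
   the contribution of x to m h_m(c x + d y). *)
Definition nherm_conv (w : nat -> R) (c x d y : R) m :=
  \sum_(j < m.+1) w j * c ^+ j * d ^+ (m - j) * ((h j).[x] * (h (m - j)).[y]).

Definition nherm_conv_pred c x d y m :=
  if m is m'.+1 then nherm_conv (fun=> 1) c x d y m' else 0.

(** In terms of generating functions, the weight [j] is the operator [z d/dz] applied to the factor
    [exp(c x z - c^2 z^2 / 2)] only. It multiplies this factor by [c x z - c^2 z^2], whose two
    monomials give the two terms on the right. *)
Lemma nherm_conv_wt c x d y m :
  nherm_conv (fun j => j%:R) c x d y m.+1 =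
  c * x * nherm_conv (fun=> 1) c x d y m - c ^+ 2 * nherm_conv_pred c x d y m.
Proof.
rewrite /nherm_conv big_ord_recl !mul0r add0r.
transitivity (\sum_(j < m.+1)
  (c * x * (1 * c ^+ j * d ^+ (m - j) * ((h j).[x] * (h (m - j)).[y]))
    - c ^+ j.+1 * d ^+ (m - j) * (nherm_pred j x * (h (m - j)).[y]))).
  apply: eq_bigr => j _; rewrite /= /bump /= add1n subSS.
  have e := nherm_rec j x; have {}e : x * (h j).[x] = j.+1%:R * (h j.+1).[x] + nherm_pred j x.
    by rewrite e subrK.
  transitivity (c ^+ j.+1 * d ^+ (m - j) * ((x * (h j).[x]) - nherm_pred j x) * (h (m - j)).[y]).
    by rewrite e addrK; ring.
  by rewrite exprS; ring.
rewrite sumrB -mulr_sumr; congr (_ - _).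
case: m => [|m]; first by rewrite big_ord1 mul0r !mulr0.
rewrite big_ord_recl /= mul0r mulr0 add0r mulr_sumr; apply: eq_bigr => j _.
rewrite /bump /= add1n subSS !exprS; ring.
Qed.

Lemma nherm_conv_sym c x d y m :
  \sum_(j < m.+1) (m - j)%:R * c ^+ j * d ^+ (m - j) * ((h j).[x] * (h (m - j)).[y])
  = nherm_conv (fun j => j%:R) d y c x m.
Proof.
rewrite /nherm_conv (reindex_inj rev_ord_inj) /=; apply: eq_bigr => j _.
rewrite subSS subKn -1?ltnS //; ring.
Qed.

(** Writing [m.+1] as [j + (m.+1 - j)] splits [m.+1] times the convolution into two weighted ones;
    by [nherm_conv_wt] and [c ^+ 2 + d ^+ 2 = 1] they add up to the three-term recurrence at
    [c * x + d * y]. *)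
Lemma nherm_addition c x d y m : c ^+ 2 + d ^+ 2 = 1 ->
  (h m).[c * x + d * y] = nherm_conv (fun=> 1) c x d y m.
Proof.
move=> cd; have symm k : nherm_conv (fun=> 1) d y c x k = nherm_conv (fun=> 1) c x d y k.
  rewrite /nherm_conv [RHS](reindex_inj rev_ord_inj) /=; apply: eq_bigr => j _.
  rewrite subSS subKn -1?ltnS //; ring.
elim/ltn_ind: m => -[_|m IH].
  by rewrite /nherm_conv big_ord1 nherm0 !hornerC !expr0 !mulr1.
have m0 : m.+1%:R != 0 :> R by rewrite pnatr_eq0.
apply: (mulfI m0); rewrite nherm_rec.
transitivity (nherm_conv (fun j => j%:R) c x d y m.+1 +
              nherm_conv (fun j => j%:R) d y c x m.+1).
  rewrite !nherm_conv_wt !symm IH //.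
  have -> : nherm_conv_pred d y c x m = nherm_conv_pred c x d y m by case: m {IH m0}.
  have -> : nherm_pred m (c * x + d * y) = nherm_conv_pred c x d y m.
    by case: m IH {m0} => [//|m] IH; exact: IH.
  by rewrite -[X in _ - X = _]mul1r -cd; ring.
rewrite -(nherm_conv_sym c x d y) -big_split /= /nherm_conv mulr_sumr; apply: eq_bigr => j _.
have jm : (j <= m.+1)%N by rewrite -ltnS.
by rewrite -!mulrA -mulrDl -natrD subnKC // !mulrA mulr1.
Qed.

(** Each [k] gives its own splitting of the same point [S], so [nherm_addition] makes all unweighted
    convolutions equal to values at [S]. Summing [nherm_conv_wt] over [k] then yields the
    recurrence, because the [c k * x k] sum to [S] and the [c k ^+ 2] to [1]. *)
Lemma nherm_sum_conv n (c x d y : 'I_n -> R) m :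
  \sum_k c k ^+ 2 = 1 ->
  (forall k, c k ^+ 2 + d k ^+ 2 = 1) ->
  (forall k, c k * x k + d k * y k = \sum_i c i * x i) ->
  m.+1%:R * (h m.+1).[\sum_i c i * x i] =
  \sum_k nherm_conv (fun j => j%:R) (c k) (x k) (d k) (y k) m.+1.
Proof.
move=> c1 cd S; rewrite nherm_rec.
under [RHS]eq_bigr => k _ do rewrite nherm_conv_wt.
rewrite sumrB; congr (_ - _).
  under [RHS]eq_bigr => k _ do rewrite -nherm_addition ?cd // S.
  by rewrite -mulr_suml.
case: m => [|m] /=; first by rewrite big1 // => k _; rewrite mulr0.
under [RHS]eq_bigr => k _ do rewrite -nherm_addition ?cd // S.
by rewrite -mulr_suml c1 mul1r.
Qed.

End HermiteAddition.

(** * Dominated limits of polynomials *)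

Section PolynomialClosure.
Variable R : realType.
Implicit Types (f g : R -> R) (a b c x y : R).

(** A dominating family stable under products and, after enlarging [c], under sums; the summand [1]
    in the exponent allows constants to be absorbed as well. *)
Definition expdom c x : R := expR (c * (1 + `|x|)).

Lemma expdom_ge0 c x : 0 <= expdom c x. Proof. exact: expR_ge0. Qed.

Lemma expdomM a b x : expdom a x * expdom b x = expdom (a + b) x.
Proof. by rewrite /expdom -expRD mulrDl. Qed.

Lemma le_expdom a b x : a <= b -> expdom a x <= expdom b x.
Proof. by move=> ab; rewrite ler_expR ler_wpM2r // addr_ge0. Qed.

Lemma expdom_ge1 c x : 0 <= c -> 1 <= expdom c x.
Proof. by move=> c0; rewrite -expR0 ler_expR mulr_ge0 // addr_ge0. Qed.

(** For [u, v >= 1] one has [u + v <= 2 u v], and [expdom 1] is at least [2]. *)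
Lemma expdomD a b x : 0 <= a -> 0 <= b ->
  expdom a x + expdom b x <= expdom (a + b + 1) x.
Proof.
move=> a0 b0; rewrite -!expdomM.
have A := expdom_ge1 a x a0; have B := expdom_ge1 b x b0.
have E : 2 <= expdom 1 x.
  apply: (le_trans (expR_ge1Dx 1)); rewrite ler_expR mul1r lerDl //.
move: (expdom a x) (expdom b x) (expdom 1 x) A B E => u v w A B E.
have uv : u + v <= (u * v) * 2 by nra.
by rewrite (le_trans uv) // ler_wpM2l // mulr_ge0 //; lra.
Qed.

Lemma ler_expdom c x : 0 <= c -> c <= expdom c x.
Proof.
move=> c0; apply: (@le_trans _ _ (1 + c)); first by rewrite lerDr.
by rewrite (le_trans (expR_ge1Dx c)) // ler_expR ler_peMr // lerDl.
Qed.

Lemma norm_le_expdom x : `|x| <= expdom 1 x.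
Proof.
rewrite /expdom mul1r; apply: le_trans (expR_ge1Dx _).
by rewrite addrA lerDr addr_ge0.
Qed.

Lemma poly_expdom (p : {poly R}) :
  exists2 c, 0 <= c & forall x, `|p.[x]| <= expdom c x.
Proof.
elim/poly_ind: p => [|p k [c c0 cP]].
  by exists 0 => // x; rewrite horner0 normr0 expdom_ge0.
exists (c + 1 + `|k| + 1); first by rewrite !addr_ge0.
move=> x; rewrite hornerMXaddC (le_trans (ler_normD _ _)) //.
apply: (le_trans _ (expdomD (c + 1) `|k| x _ _)); rewrite ?addr_ge0 //.
apply: lerD; last exact: ler_expdom.
by rewrite normrM -expdomM ler_pM // norm_le_expdom.
Qed.

(* The least class of functions containing the polynomials and closed under the
   limits allowed by dominated convergence for every measure with finite
   exponential moments. *)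
Inductive pclosure : (R -> R) -> Prop :=
| pclosure_poly (p : {poly R}) : pclosure (fun x => p.[x])
| pclosure_lim (f_ : nat -> R -> R) f c of
    (forall n, pclosure (f_ n)) & (forall n x, `|f_ n x| <= expdom c x)
    & (forall x, f_ n x @[n --> \oo] --> f x) : pclosure f.

Lemma pclosure_expdom f : pclosure f ->
  exists2 c, 0 <= c & forall x, `|f x| <= expdom c x.
Proof.
case=> [p|f_ {}f c _ fc ff]; first exact: poly_expdom.
exists `|c| => // x.
have /cvg_norm h := ff x; rewrite -(cvg_lim _ h) //.
apply: limr_le; [exact: (cvgP _ h)|apply: nearW => n].
by rewrite (le_trans (fc n x)) // le_expdom // ler_norm.
Qed.

Lemma pclosure_measurable f : pclosure f -> measurable_fun setT f.
Proof.
elim=> [p|f_ {}f c _ mf _ ff]; first exact: measurable_poly.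
by apply: (@measurable_fun_cvg _ _ _ setT f_) => // x _; exact: ff.
Qed.

(** Nested induction: on [f] with [g] arbitrary and, once [f] is a polynomial, on [g]. In each limit
    step the other function is fixed, and its own exponential bound combines with that of the
    sequence into a common one. *)
Lemma pclosure_op2 (op : R -> R -> R) :
  (forall p q : {poly R}, exists r : {poly R}, forall x, r.[x] = op p.[x] q.[x]) ->
  (forall a b, 0 <= a -> 0 <= b -> exists c, forall x u v,
     `|u| <= expdom a x -> `|v| <= expdom b x -> `|op u v| <= expdom c x) ->
  (forall (u v : nat -> R) a b, u @ \oo --> a -> v @ \oo --> b ->
     op (u n) (v n) @[n --> \oo] --> op a b) ->
  forall f g, pclosure f -> pclosure g -> pclosure (fun x => op (f x) (g x)).
Proof.
move=> oppoly opdom oplim f g Pf; elim: Pf g => [p|f_ {}f c Pf_ IH fc ff] g Pg.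
- elim: Pg => [q|g_ {}g c Pg_ IH gc gg].
    have [r rE] := oppoly p q.
    have -> : (fun x => op p.[x] q.[x]) = (fun x => r.[x]) by apply/funext => x; rewrite rE.
    exact: pclosure_poly.
  have [a a0 ap] := poly_expdom p.
  have [b opb] := opdom a `|c| a0 (normr_ge0 c).
  apply: (@pclosure_lim (fun n x => op p.[x] (g_ n x)) _ b) => // [n x|x].
    by apply: opb => //; rewrite (le_trans (gc n x)) // le_expdom // ler_norm.
  by apply: oplim (gg x); exact: cvg_cst.
- have [b b0 gb] := pclosure_expdom _ Pg.
  have [d opd] := opdom `|c| b (normr_ge0 c) b0.
  apply: (@pclosure_lim (fun n x => op (f_ n x) (g x)) _ d) => [n|n x|x].
  + exact: IH.
  + by apply: opd => //; rewrite (le_trans (fc n x)) // le_expdom // ler_norm.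
  + by apply: oplim (ff x) _; exact: cvg_cst.
Qed.

Lemma pclosureD f g : pclosure f -> pclosure g -> pclosure (fun x => f x + g x).
Proof.
apply: pclosure_op2.
- by move=> p q; exists (p + q) => x; rewrite hornerD.
- move=> a b a0 b0; exists (a + b + 1) => x u v ua vb.
  by rewrite (le_trans (ler_normD _ _)) // (le_trans _ (expdomD _ _ _ a0 b0)) // lerD.
- by move=> u v a b; exact: cvgD.
Qed.

Lemma pclosureM f g : pclosure f -> pclosure g -> pclosure (fun x => f x * g x).
Proof.
apply: pclosure_op2.
- by move=> p q; exists (p * q) => x; rewrite hornerM.
- move=> a b a0 b0; exists (a + b) => x u v ua vb.
  by rewrite normrM -expdomM ler_pM.
- by move=> u v a b; exact: cvgM.
Qed.

Lemma pclosure_cst c : pclosure (fun=> c).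
Proof.
have -> : (fun=> c) = (fun x => (c%:P : {poly R}).[x]).
  by apply/funext => x; rewrite hornerC.
exact: pclosure_poly.
Qed.

Lemma pclosureZ c f : pclosure f -> pclosure (fun x => c * f x).
Proof. by move=> Pf; apply: pclosureM => //; exact: pclosure_cst. Qed.

Lemma pclosureX n f : pclosure f -> pclosure (fun x => f x ^+ n).
Proof.
move=> Pf; elim: n => [|n IH]; first exact: pclosure_cst.
have -> : (fun x => f x ^+ n.+1) = (fun x => f x * f x ^+ n).
  by apply/funext => x; rewrite exprS.
exact: pclosureM.
Qed.

Lemma pclosure_sum n (f_ : nat -> R -> R) : (forall i, pclosure (f_ i)) ->
  pclosure (fun x => \sum_(i < n) f_ i x).
Proof.
move=> Pf; elim: n => [|n IH].
  have -> : (fun x => \sum_(i < 0) f_ i x) = (fun=> 0).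
    by apply/funext => x; rewrite big_ord0.
  exact: pclosure_cst.
have -> : (fun x => \sum_(i < n.+1) f_ i x) = (fun x => \sum_(i < n) f_ i x + f_ n x).
  by apply/funext => x; rewrite big_ord_recr.
exact: pclosureD.
Qed.

Lemma exp_partial_sum_le y n : \sum_(0 <= k < n) `|y| ^+ k / k`!%:R <= expR `|y|.
Proof.
have := @nondecreasing_cvgn_le _ (series (exp_coeff `|y|)) _ (is_cvg_series_exp_coeff `|y|) n.
apply; apply/nondecreasing_seqP => k.
by rewrite /series /= big_nat_recr //= lerDl exp_coeff_ge0.
Qed.

(** The Taylor polynomials of the sine at [a * x + b] are bounded term by term by the exponential
    series of its absolute value. At argument [1], [sin_coeff] is the bare Taylor coefficient. *)
Lemma pclosure_sin a b : pclosure (fun x => sin (a * x + b)).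
Proof.
pose p n : {poly R} := \sum_(0 <= k < n) sin_coeff 1 k *: (a *: 'X + b%:P) ^+ k.
have pE n x : (p n).[x] = series (sin_coeff (a * x + b)) n.
  rewrite /p /series /= horner_sum; apply: eq_bigr => k _.
  rewrite hornerZ horner_exp hornerD hornerZ hornerX hornerC !sin_coeffE /=.
  by rewrite expr1n mulr1.
apply: (@pclosure_lim (fun n x => (p n).[x]) _ (`|a| + `|b|)) => [n|n x|x].
- exact: pclosure_poly.
- rewrite pE /series /= (le_trans (ler_norm_sum _ _ _)) //.
  apply: (@le_trans _ _ (expR `|a * x + b|)); last first.
    rewrite ler_expR (le_trans (ler_normD _ _)) // normrM.
    have := normr_ge0 a; have := normr_ge0 b; have := normr_ge0 x; nra.
  apply: le_trans (exp_partial_sum_le (a * x + b) n).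
  apply: ler_sum => k _; rewrite /sin_coeff /= !normrM normfV normrX ger0_norm //.
  rewrite [`|k`!%:R|]ger0_norm // ler_pM2r ?invr_gt0 ?ltr0n ?fact_gt0 //.
  rewrite normrN1 expr1n mulr1 normrX.
  by case: odd; rewrite ?mul1r ?mul0r ?exprn_ge0.
- have -> : (fun n => (p n).[x]) = series (sin_coeff (a * x + b)).
    by apply/funext => n; rewrite pE.
  rewrite sin.unlock; exact: is_cvg_series_sin_coeff.
Qed.

(* Polynomials in u^2 increasing to |u| on [-1, 1]. *)
Fixpoint abs_approx (u : R) (n : nat) : R :=
  if n is n'.+1 then abs_approx u n' + (u ^+ 2 - abs_approx u n' ^+ 2) / 2 else 0.

(** With [v] the absolute value of [u] and [q] the current approximation, the next error is
    [(v - q) (1 - (v + q) / 2)]; since [0 <= q <= v <= 1], the second factor lies between [0] and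
    [1 - v / 2]. *)
Lemma abs_approx_bound u n : `|u| <= 1 ->
  0 <= abs_approx u n <= `|u| /\ `|u| - abs_approx u n <= (1 - `|u| / 2) ^+ n * `|u|.
Proof.
move=> u1; elim: n => [|n [/andP[q0 qu] IH]] /=.
  by rewrite normr_ge0 lexx subr0 expr0 mul1r lexx.
have u0 := normr_ge0 u; rewrite -real_normK ?num_real // [_ ^+ n.+1]exprS.
move: q0 qu IH; set q := abs_approx u n; set r := (1 - _) ^+ n; set v := `|u| in u0 u1 * => q0 qu IH.
have E : v - (q + (v ^+ 2 - q ^+ 2) / 2) = (v - q) * (1 - (v + q) / 2) by field.
have D : (v ^+ 2 - q ^+ 2) / 2 = (v - q) * (v + q) / 2 by field.
split; first (apply/andP; split).
- rewrite D addr_ge0 // divr_ge0 // mulr_ge0 ?subr_ge0 // addr_ge0 //.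
- by rewrite -subr_ge0 E mulr_ge0 ?subr_ge0 //; lra.
- rewrite E -mulrA [leRHS]mulrC; apply: ler_pM => //; rewrite ?subr_ge0 //; lra.
Qed.

Lemma cvg_abs_approx u : `|u| <= 1 -> abs_approx u n @[n --> \oo] --> `|u|.
Proof.
move=> u1; have u0 := normr_ge0 u.
have lim0 : (1 - `|u| / 2) ^+ n * `|u| @[n --> \oo] --> (0 : R).
  (* For [u = 0] the geometric ratio is [1], but the factor in front vanishes. *)
  move: u0; rewrite le_eqVlt => /orP[/eqP <-|u0].
    by under eq_fun do rewrite mulr0; exact: cvg_cst.
  rewrite -(mul0r `|u|); apply: cvgMr_tmp; apply: cvg_expr.
  by rewrite ger0_norm; lra.
have lim1 : `|u| - (1 - `|u| / 2) ^+ n * `|u| @[n --> \oo] --> `|u|.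
  by rewrite -[X in _ --> X]subr0; apply: cvgB => //; exact: cvg_cst.
apply: (squeeze_cvgr _ lim1 (cvg_cst `|u|)); apply: nearW => n.
by have [/andP[_ ->] ?] := abs_approx_bound u n u1; rewrite andbT; lra.
Qed.

Lemma pclosure_norm f : pclosure f -> (forall x, `|f x| <= 1) ->
  pclosure (fun x => `|f x|).
Proof.
move=> Pf f1; apply: (@pclosure_lim (fun n x => abs_approx (f x) n) _ 0) => [n|n x|x].
- elim: n => [|n IH] /=; first exact: pclosure_cst.
  apply: pclosureD => //.
  apply: (@pclosureM _ (fun=> 2^-1)); last exact: pclosure_cst.
  apply: pclosureD; first exact: pclosureX.
  under eq_fun do rewrite -mulN1r.
  by apply: pclosureZ; exact: pclosureX.
- have [/andP[q0 qf] _] := abs_approx_bound (f x) n (f1 x).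
  by rewrite ger0_norm // (le_trans qf) // (le_trans (f1 x)) // expdom_ge1.
- exact: cvg_abs_approx.
Qed.

(* With g = max(f, 0), 1_(f > 0) is the limit of 1 - (1 - g)^n. *)
Lemma pclosure_gt0 f : pclosure f -> (forall x, `|f x| <= 1) ->
  pclosure (fun x => (0 < f x)%R%:R).
Proof.
move=> Pf f1; pose g x := 2^-1 * (f x + `|f x|).
have Pg : pclosure g.
  by apply/pclosureZ/pclosureD => //; exact: pclosure_norm.
have g01 x : 0 <= g x <= 1.
  have := f1 x; have := ler_norm (- f x); have := ler_norm (f x); rewrite normrN /g; lra.
have Pg' : pclosure (fun x => 1 + -1 * g x).
  by apply: pclosureD; [exact: pclosure_cst|exact: pclosureZ].
apply: (@pclosure_lim (fun n x => 1 + -1 * (1 + -1 * g x) ^+ n) _ 0) => [n|n x|x].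
- by apply: pclosureD; [exact: pclosure_cst|apply/pclosureZ/pclosureX].
- apply: (@le_trans _ _ 1); last exact: expdom_ge1.
  have /andP[g0 g1] := g01 x.
  have h0 : 0 <= 1 + -1 * g x by lra.
  have h1 : 1 + -1 * g x <= 1 by lra.
  have := exprn_ge0 n h0; have := exprn_ile1 n h0 h1.
  by move=> ? ?; rewrite ger0_norm; lra.
- case: ltP => [fx|fx] /=; last first.
    have -> : g x = 0 by rewrite /g ler0_norm // subrr mulr0.
    by under eq_fun do rewrite mulr0 addr0 expr1n mulr1 subrr; exact: cvg_cst.
  have -> : g x = f x by rewrite /g gtr0_norm //; field.
  suff : 1 + -1 * (1 + -1 * f x) ^+ n @[n --> \oo] --> 1 + -1 * (0 : R).
    by rewrite mulr0 addr0.
  apply: cvgD; first exact: cvg_cst.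
  apply: cvgMl_tmp; apply: cvg_expr; have := f1 x; have := ler_norm (f x) => *.
  by rewrite ger0_norm; lra.
Qed.

(* For fixed x, sin ((x - a) / (n + 1)) eventually has the sign of x - a. *)
Lemma pclosure_ray a : pclosure (fun x => (a < x)%R%:R).
Proof.
apply: (@pclosure_lim (fun n x => (0 < sin (n.+1%:R^-1 * x + - (n.+1%:R^-1 * a)))%R%:R) _ 0)
  => [n|n x|x].
- apply: pclosure_gt0; first exact: pclosure_sin.
  by move=> x; rewrite ler_norml sin_geN1 sin_le1.
- by rewrite ger0_norm // (@le_trans _ _ 1) ?expdom_ge1 //; case: (0 < _).
- apply: cvg_near_cst; near=> n; rewrite -mulrBr.
  have n0 : 0 < n.+1%:R^-1 :> R by rewrite invr_gt0.
  have np : `|x - a| < pi * n.+1%:R.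
    rewrite -ltr_pdivrMl ?pi_gt0 //.
    apply: (@lt_le_trans _ _ n%:R); last by rewrite ler_nat.
    near: n; exact: nbhs_infty_gtr.
  have np' : n.+1%:R^-1 * `|x - a| < pi by rewrite mulrC ltr_pdivrMr.
  case: (ltgtP a x) => [ax|xa|->]; last by rewrite subrr mulr0 sin0 ltxx.
    rewrite sin_gt0_pi // mulr_gt0 ?subr_gt0 //=.
    by rewrite -[x - a]gtr0_norm ?subr_gt0.
  rewrite -[_ * _]opprK sinN oppr_gt0 ltNge ltW //.
  rewrite sin_gt0_pi // -mulrN opprB mulr_gt0 ?subr_gt0 //=.
  by rewrite -[a - x]gtr0_norm ?subr_gt0 // distrC.
Unshelve. all: by end_near. Qed.

End PolynomialClosure.

(** * Bounded measurable functions as dominated limits of polynomials *)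

Section PolynomialClosureMeasurable.
Import HBNNSimple.
Variable R : realType.
Implicit Types (f g : R -> R).

(** Open rays form a pi-system generating the Borel sets, and the sets with indicator in the class
    form a Dynkin system: complements use [1 - \1_S], and disjoint unions are limits of partial sums
    bounded by [1]. *)
Lemma pclosure_indic (A : set R) : measurable A -> pclosure R \1_A.
Proof.
move=> mA.
have norm1 (B : set R) x : `|\1_B x : R| <= expdom R 0 x.
  rewrite indicE ger0_norm // (@le_trans _ _ 1) ?expdom_ge1 //.
  by case: (x \in B).
suff: forall S, <<s @RGenOInfty.G R >> S -> pclosure R \1_S.
  apply; suff : (@RGenOInfty.G R).-sigma.-measurable A by [].
  by rewrite -RGenOInfty.measurableE.
apply: (@dynkin_induction _ R (@RGenOInfty.G R) (fun A => pclosure R \1_A)).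
- exact: RGenOInfty.measurableE.
- move=> _ _ [a ->] [b ->]; exists (Num.max a b).
  by apply/seteqP; split => x /=; rewrite !in_itv /= !andbT gt_max; move/andP.
- by rewrite indicT; exact: pclosure_cst.
- move=> _ [a ->].
  have -> : \1_`]a, +oo[ = (fun x : R => (a < x)%R%:R) :> (R -> R).
    by apply/funext => x; rewrite indicE mem_setE in_itv /= andbT.
  exact: pclosure_ray.
- move=> S _ PS.
  have -> : \1_(~` S) = (fun x => 1 + -1 * \1_S x) :> (R -> R).
    by apply/funext => x; rewrite !indicE in_setC; case: (x \in S); rewrite /=; ring.
  by apply: pclosureD; [exact: pclosure_cst|exact: pclosureZ].
- move=> F mF tF PF.
  apply: (@pclosure_lim _ (fun n x => \sum_(i < n) \1_(F i) x) _ 0) => [n|n x|x].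
  + exact: (@pclosure_sum _ n (fun i => \1_(F i))).
  + rewrite ger0_norm; last by rewrite sumr_ge0.
    apply: (@le_trans _ _ 1); last exact: expdom_ge1.
    rewrite -lee_fin -sumEFin.
    apply: (@le_trans _ _ (\1_(\bigcup_k F k) x)%:E).
      rewrite indic_bigcup // -(big_mkord xpredT (fun i => (\1_(F i) x)%:E)).
      by apply: nneseries_lim_ge => i _ _; rewrite lee_fin.
    by rewrite lee_fin indicE; case: (_ \in _).
  + suff : EFin \o (fun n => \sum_(i < n) \1_(F i) x : R) @ \oo -->
        (\1_(\bigcup_k F k) x : R)%:E by move/fine_cvg.
    rewrite indic_bigcup //.
    have -> : EFin \o (fun n => \sum_(i < n) \1_(F i) x : R) =
        (fun n => \sum_(0 <= i < n) (\1_(F i) x)%:E)%E.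
      by apply/funext => n /=; rewrite -sumEFin big_mkord.
    by apply: is_cvg_nneseries => i _ _; rewrite lee_fin.
Qed.

Lemma pclosure_nnsfun (f : {nnsfun R >-> R}) : pclosure R f.
Proof.
pose s := finmap.enum_fset (fset_set (range f)).
have -> : (f : R -> R) =
    (fun x => \sum_(i < size s) s`_i * \1_(f @^-1` [set s`_i]) x).
  apply/funext => x; rewrite fimfunE fsbig_finite //=.
  by rewrite (big_nth 0) big_mkord.
apply: (@pclosure_sum _ _ (fun i x => s`_i * \1_(f @^-1` [set s`_i]) x)) => i.
by apply: pclosureZ; apply: pclosure_indic; exact: measurable_sfunP.
Qed.

(** Adding [M] makes [g] nonnegative; its increasing simple approximations then stay below
    [M + M]. *)
Lemma pclosure_bounded g (M : R) : measurable_fun setT g ->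
  (forall x, `|g x| <= M) -> pclosure R g.
Proof.
move=> mg gM; have M0 : 0 <= M by exact: le_trans (gM 0).
have mgM : measurable_fun setT (fun x => (g x + M)%:E).
  by apply/measurable_EFinP; apply: measurable_funD.
have gM0 x : 0 <= g x + M.
  by have := gM x; rewrite ler_norml => /andP[? _]; lra.
pose h := nnsfun_approx measurableT mgM.
have cvh x : h n x @[n --> \oo] --> g x + M.
  suff : EFin \o h ^~ x @ \oo --> (g x + M)%:E by move/fine_cvg.
  by apply: (@cvg_nnsfun_approx _ _ _ _ measurableT _ mgM) => // y _; rewrite lee_fin.
have -> : g = (fun x => (g x + M) + - M) by apply/funext => x; rewrite addrK.
apply: pclosureD; last exact: pclosure_cst.
apply: (@pclosure_lim _ h _ (M + M)) => [n|n x|//]; first exact: pclosure_nnsfun.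
apply: (@le_trans _ _ (M + M)); last by rewrite ler_expdom // addr_ge0.
rewrite ger0_norm //; apply: (@le_trans _ _ (g x + M)); last first.
  by rewrite lerD2r; have := gM x; rewrite ler_norml => /andP[].
rewrite -(cvg_lim _ (cvh x)) //; apply: nondecreasing_cvgn_le.
  by move=> m k mk; exact/lefP/nd_nnsfun_approx.
exact: (cvgP _ (cvh x)).
Qed.

End PolynomialClosureMeasurable.

(** * Gaussian integrals *)

Section Density.
Context d (T : measurableType d) (R : realType).
Variables (nu : {finite_measure set T -> \bar R})
          (mu : {sigma_finite_measure set T -> \bar R}).
Variable p : T -> R.
Hypotheses (mp : measurable_fun setT p) (p0 : forall x, 0 <= p x).
Hypothesis nup : forall A, measurable A -> nu A = (\int[mu]_(x in A) (p x)%:E)%E.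
Local Open Scope ereal_scope.

Let mEp : measurable_fun setT (EFin \o p). Proof. exact/measurable_EFinP. Qed.

Lemma density_dominates : nu `<< mu.
Proof.
apply/null_content_dominatesP => A mA A0; rewrite nup //.
by apply: null_set_integral => //; exact: measurable_funTS.
Qed.

(** The change of variables holds for the Radon-Nikodym derivative, and [p] agrees with it almost
    everywhere because both integrate to [nu] on every measurable set. *)
Lemma ge0_integral_density (f : T -> \bar R) :
  measurable_fun setT f -> (forall x, 0 <= f x) ->
  \int[nu]_x f x = \int[mu]_x (f x * (p x)%:E).
Proof.
move=> mf f0; have numu := density_dominates.
rewrite -(Radon_Nikodym_SigmaFinite.change_of_variables numu) //.
have mRN : measurable_fun setT (Radon_Nikodym_SigmaFinite.f nu mu).
  exact: measurable_int (Radon_Nikodym_SigmaFinite.f_integrable numu).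
apply: ae_eq_integral => //; try exact: emeasurable_funM.
apply: ae_eqe_mul2l; apply: integral_ae_eq => //.
  exact: Radon_Nikodym_SigmaFinite.f_integrable.
by move=> A _ mA; rewrite -Radon_Nikodym_SigmaFinite.f_integral // nup.
Qed.

Lemma integrable_density (f : T -> R) : measurable_fun setT f ->
  nu.-integrable setT (EFin \o f) <-> mu.-integrable setT (fun x => (f x * p x)%:E).
Proof.
move=> mf; have mf' : measurable_fun setT (fun x => `|(f x)%:E|).
  by apply: measurableT_comp => //; exact/measurable_EFinP.
have E : \int[nu]_x `|(f x)%:E| = \int[mu]_x `|(f x * p x)%:E|.
  rewrite (ge0_integral_density _ _) //; apply: eq_integral => x _.
  by rewrite EFinM abseM [X in _ = _ * X]gee0_abs // lee_fin.
split => /integrableP[_ h]; apply/integrableP; split.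
- by apply/measurable_EFinP; exact: measurable_funM.
- by rewrite -E.
- exact/measurable_EFinP.
- by rewrite /= E.
Qed.

Lemma Rintegral_density (f : T -> R) : nu.-integrable setT (EFin \o f) ->
  (\int[nu]_x f x = \int[mu]_x (f x * p x))%R.
Proof.
move=> fi; have mEf := measurable_int _ fi.
have mf : measurable_fun setT f by exact/measurable_EFinP.
congr fine; rewrite integralE [RHS]integralE; congr (_ - _).
- rewrite ge0_integral_density //; last exact: measurable_funepos.
  apply: eq_integral => x _; rewrite !funeposE.
  by rewrite EFinM -[0%E in RHS](mul0e (p x)%:E) maxe_pMl ?lee_fin.
- rewrite ge0_integral_density //; last exact: measurable_funeneg.
  apply: eq_integral => x _; rewrite !funenegE.
  by rewrite /= -mulNr EFinM -[0%E in RHS](mul0e (p x)%:E) maxe_pMl ?lee_fin.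
Qed.

End Density.

(** * The standard Gaussian measure and its exponential moments *)

Section Gaussian.
Variable R : realType.
Implicit Types (x c : R) (p q : {poly R}).
Local Notation gauss := (normal_prob (0 : R) 1).
Local Notation leb := (@lebesgue_measure R).

Lemma gauss_densE x : gauss_dens x = normal_pdf 0 1 x.
Proof.
rewrite normal_pdfE ?oner_neq0 // /gauss_dens /normal_peak /normal_fun.
by rewrite subr0 expr1n !mul1r mulrC -mulr_natl mulr1 -[pi *+ 2]mulr_natl.
Qed.

Lemma gauss_dens_gt0 x : 0 < gauss_dens x.
Proof.
by rewrite /gauss_dens divr_gt0 ?expR_gt0 // sqrtr_gt0 mulr_gt0 ?pi_gt0.
Qed.

Lemma gauss_dens_ge0 x : 0 <= gauss_dens x.
Proof. exact/ltW/gauss_dens_gt0. Qed.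

Lemma measurable_gauss_dens : measurable_fun setT (@gauss_dens R).
Proof.
have -> : @gauss_dens R = normal_pdf 0 1 by apply/funext => x; exact: gauss_densE.
exact: measurable_normal_pdf.
Qed.

Lemma gauss_density A : measurable A ->
  gauss A = (\int[leb]_(x in A) (gauss_dens x)%:E)%E.
Proof.
by move=> _; rewrite /normal_prob; apply: eq_integral => x _; rewrite gauss_densE.
Qed.

Lemma ge0_integral_gauss (f : R -> \bar R) : measurable_fun setT f ->
  (forall x, 0 <= f x)%E ->
  (\int[gauss]_x f x = \int[leb]_x (f x * (gauss_dens x)%:E))%E.
Proof.
exact: (ge0_integral_density _ _ R gauss leb _ measurable_gauss_dens gauss_density).
Qed.

Lemma integrable_gauss (f : R -> R) : measurable_fun setT f ->
  gauss.-integrable setT (EFin \o f) <->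
  leb.-integrable setT (fun x => (f x * gauss_dens x)%:E).
Proof.
exact: (integrable_density _ _ R gauss leb _ measurable_gauss_dens gauss_dens_ge0 gauss_density).
Qed.

Lemma Rintegral_gauss (f : R -> R) : gauss.-integrable setT (EFin \o f) ->
  \int[gauss]_x f x = \int[leb]_x (f x * gauss_dens x).
Proof.
exact: (Rintegral_density _ _ R gauss leb _ measurable_gauss_dens gauss_dens_ge0 gauss_density).
Qed.

(** Completing the square; exponential moments thus reduce to the integrability of a shifted normal
    density. *)
Lemma expR_gauss_dens c x :
  expR (c * x) * gauss_dens x = expR (c ^+ 2 / 2) * normal_pdf c 1 x.
Proof.
rewrite gauss_densE !normal_pdfE ?oner_neq0 // /normal_fun mulrCA [RHS]mulrCA -!expRD.
congr (_ * expR _); rewrite expr1n; lra.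
Qed.

Lemma gauss_integrable_expR c : gauss.-integrable setT (fun x => (expR (c * x))%:E).
Proof.
have m : measurable_fun setT (fun x : R => expR (c * x)).
  by apply: measurableT_comp => //; exact: measurable_funM.
apply/(integrable_gauss _ m).
under [X in _.-integrable _ X]eq_fun do rewrite expR_gauss_dens EFinM.
by apply: integrableZl => //; exact: integrable_normal_pdf.
Qed.

Lemma measurable_expdom c : measurable_fun setT (expdom R c).
Proof.
apply: measurableT_comp => //; apply: measurable_funM => //.
by apply: measurable_funD => //; exact: measurable_normr.
Qed.

Lemma gauss_integrable_expdom c : gauss.-integrable setT (EFin \o expdom R c).
Proof.
have gi : gauss.-integrable setT (EFin \o
    (fun x => expR `|c| * (expR (`|c| * x) + expR (- `|c| * x)))).
  under [X in _.-integrable _ X]eq_fun do rewrite /= EFinM EFinD.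
  by apply: integrableZl => //; apply: integrableD => //; exact: gauss_integrable_expR.
apply: (le_integrable _ _ _ gi) => //.
  by apply/measurable_EFinP; exact: measurable_expdom.
move=> x _; rewrite /= lee_fin [leLHS]ger0_norm ?expdom_ge0 //.
rewrite [leRHS]ger0_norm ?mulr_ge0 ?addr_ge0 ?expR_ge0 //.
apply: (@le_trans _ _ (expdom R `|c| x)); first exact/le_expdom/ler_norm.
rewrite /expdom [_ * (1 + _)]mulrDr mulr1 expRD ler_pM2l ?expR_gt0 //.
by case: (ger0P x) => _; rewrite ?mulrN ?mulNr ?lerDl ?lerDr expR_ge0.
Qed.

End Gaussian.

(** * Integrability and dominated convergence under exponential moments *)

Section ExponentialMoments.
Context (R : realType) (mu : {measure set (measurableTypeR R) -> \bar R}).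
Hypothesis mu_exp : forall c, mu.-integrable setT (EFin \o expdom R c).

Lemma integrable_of_expdom (f : R -> R) c : measurable_fun setT f ->
  (forall x, `|f x| <= expdom R c x) -> mu.-integrable setT (EFin \o f).
Proof.
move=> mf fc; apply: (le_integrable _ _ _ (mu_exp c)) => //; first exact/measurable_EFinP.
by move=> x _ /=; rewrite lee_fin [leRHS]ger0_norm ?expdom_ge0.
Qed.

Lemma integrable_pclosure (f : R -> R) : pclosure R f -> mu.-integrable setT (EFin \o f).
Proof.
move=> Pf; have [c _ fc] := pclosure_expdom _ _ Pf.
by apply: (integrable_of_expdom _ c) => //; exact: pclosure_measurable.
Qed.

Lemma integrable_horner (p : {poly R}) : mu.-integrable setT (EFin \o horner p).
Proof. exact: (integrable_pclosure _ (pclosure_poly _ p)). Qed.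

Lemma Rintegral_dominated_cvg (f_ : nat -> R -> R) f c :
  (forall n, measurable_fun setT (f_ n)) -> 
  (forall n x, `|f_ n x| <= expdom R c x) ->
  (forall x, f_ n x @[n --> \oo] --> f x) ->
  \int[mu]_x f_ n x @[n --> \oo] --> \int[mu]_x f x.
Proof.
move=> mf_ fc ff.
have mf : measurable_fun setT f.
  by apply: (@measurable_fun_cvg _ _ _ setT f_) => // x _; exact: ff.
have [|||||fi _ h] := @dominated_convergence _ _ _ mu setT measurableT
    (fun n => EFin \o f_ n) (EFin \o f) (EFin \o expdom R c).
- move=> n. apply/measurable_EFinP; exact: mf_.
- exact/measurable_EFinP.
- by apply: aeW => x _; apply: cvg_EFin; [exact: nearW|exact: ff].
- exact: mu_exp.
- by apply: aeW => x n _; rewrite /= lee_fin.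
apply: fine_cvg; rewrite fineK; first exact: h.
exact: integrable_fin_num.
Qed.

End ExponentialMoments.

(** * Gaussian integration by parts and orthogonality *)

Section GaussianPolynomials.
Variable R : realType.
Implicit Types (x c : R) (p q : {poly R}).
Local Notation gauss := (normal_prob (0 : R) 1).
Local Notation leb := (@lebesgue_measure R).

Definition gint p : R := \int[gauss]_x p.[x].

Lemma gauss_integrable_horner p : gauss.-integrable setT (EFin \o horner p).
Proof. exact: (integrable_horner R gauss (gauss_integrable_expdom R)). Qed.
Hint Resolve gauss_integrable_horner : core.

Lemma gintD p q : gint (p + q) = gint p + gint q.
Proof. by rewrite /gint -RintegralD //; apply: eq_Rintegral => x _; rewrite hornerD. Qed.

Lemma gintZ c p : gint (c *: p) = c * gint p.
Proof. by rewrite /gint -RintegralZl //; apply: eq_Rintegral => x _; rewrite hornerZ. Qed.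

Lemma gintB p q : gint (p - q) = gint p - gint q.
Proof. by rewrite -scaleN1r gintD gintZ mulN1r. Qed.

Lemma gint_sum n (p : 'I_n -> {poly R}) : gint (\sum_i p i) = \sum_i gint (p i).
Proof.
apply: (big_morph gint gintD); rewrite -(scale0r 0) gintZ mul0r //.
Qed.

Lemma gintC c : gint c%:P = c.
Proof.
rewrite /gint; under eq_Rintegral do rewrite hornerC.
rewrite Rintegral_cst // (_ : fine _ = 1) ?mulr1 //.
by rewrite -[RHS]/(fine 1%E) -(@probability_setT _ _ _ gauss).
Qed.

Lemma is_derive_gauss_dens x : is_derive x 1 (@gauss_dens R) (- x * gauss_dens x).
Proof.
have D1 : is_derive x 1 (fun x : R => - (x ^+ 2) / 2) (- x).
  by apply: is_derive_eq; rewrite /GRing.scale /=; lra.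
have D2 : is_derive x 1 (fun x : R => expR (- (x ^+ 2) / 2)) (expR (- (x ^+ 2) / 2) * (- x)).
  exact: (@is_derive1_comp _ expR).
have D3 : is_derive x 1 (fun=> (Num.sqrt (2 * pi))^-1 : R) 0 by exact: is_derive_cst.
rewrite /gauss_dens; apply: is_derive_eq; rewrite /GRing.scale /=; ring.
Qed.

Lemma is_derive_horner_gauss_dens p x :
  is_derive x 1 (fun x => p.[x] * gauss_dens x) ((p^`() - 'X * p).[x] * gauss_dens x).
Proof.
have D := is_derive_gauss_dens x.
by apply: is_derive_eq; rewrite /GRing.scale /= !(hornerD, hornerN, hornerM, hornerX); ring.
Qed.

(** These are the boundary terms of the integration by parts in [gauss_ibp]. *)
Lemma horner_gauss_dens_cvg0 p :
  p.[n%:R] * gauss_dens n%:R - p.[- n%:R] * gauss_dens (- n%:R : R) @[n --> \oo] --> (0 : R).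
Proof.
have [c c0 pc] := poly_expdom R p.
(* From [(c + 1) t - t^2 / 2 <= (c + 1)^2 / 2] with [t] the absolute value of [x]: the extra unit
   beside [c] pays for the decaying factor [exp(-t)]. *)
pose K := expR c * expR ((c + 1) ^+ 2 / 2) / Num.sqrt (2 * pi).
have s0 : 0 < Num.sqrt (2 * pi) :> R by rewrite sqrtr_gt0 mulr_gt0 // pi_gt0.
have bound x : `|p.[x] * gauss_dens x| <= K * expR (- `|x|).
  rewrite normrM [X in _ * X]ger0_norm ?gauss_dens_ge0 //.
  apply: (le_trans (ler_wpM2r (gauss_dens_ge0 _ x) (pc x))).
  rewrite /K /gauss_dens mulrA [leRHS]mulrAC ler_pM2r ?invr_gt0 //.
  rewrite /expdom -!expRD ler_expR -[x ^+ 2]real_normK ?num_real //.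
  have := sqr_ge0 (`|x| - (c + 1)); lra.
have cvgK : (K + K) * expR (- n%:R) @[n --> \oo] --> (0 : R).
  by rewrite -(mulr0 (K + K)); apply: cvgMl_tmp; exact: cvgn_expR.
apply/cvgr0Pnorm_le => e e0; near=> n.
apply: (@le_trans _ _ ((K + K) * expR (- n%:R))).
  rewrite (le_trans (ler_normB _ _)) // mulrDl.
  by apply: lerD; rewrite (le_trans (bound _)) // ?normrN ger0_norm.
rewrite (le_trans (ler_norm _)) //.
by near: n; move/cvgr0Pnorm_le : cvgK; apply.
Unshelve. all: by end_near. Qed.

(** Stein's identity. The function [(p' - x p) phi] is the derivative of [p phi]; its integral over
    a growing symmetric interval is a boundary term tending to [0], while dominated convergence
    gives the full integral. *)
Lemma gauss_ibp p : gint ('X * p) = gint p^`().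
Proof.
apply/eqP; rewrite -subr_eq0 -oppr_eq0 opprB -gintB; apply/eqP.
set q := p^`() - 'X * p; pose I n := `[- n%:R, n%:R]%classic : set R.
have [c c0 qc] := poly_expdom R q.
have mqI n : measurable_fun setT (fun x => q.[x] * \1_(I n.+1) x).
  apply: measurable_funM; first exact: measurable_poly.
  by apply: measurable_indic; exact: measurable_itv.
have intI n : \int[gauss]_x (q.[x] * \1_(I n.+1) x) =
    p.[n.+1%:R] * gauss_dens n.+1%:R - p.[- n.+1%:R] * gauss_dens (- n.+1%:R : R).
  rewrite Rintegral_gauss; last first.
    apply: (integrable_of_expdom R gauss (gauss_integrable_expdom R) _ c).
      exact: mqI.
    move=> x; rewrite normrM (le_trans _ (qc x)) // ler_piMr //.
    by rewrite indicE ger0_norm //; case: (_ \in _).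
  have -> : \int[leb]_x (q.[x] * \1_(I n.+1) x * gauss_dens x) =
      \int[leb]_(x in I n.+1) (q.[x] * gauss_dens x).
    rewrite [RHS]Rintegral_mkcond; apply: eq_Rintegral => x _.
    by rewrite patch_indic /= mulrAC.
  rewrite /Rintegral (@continuous_FTC2 _ (fun x => q.[x] * gauss_dens x)
    (fun x => p.[x] * gauss_dens x)) //.
  - by rewrite -subr_gt0 opprK -natrD ltr0n.
  - apply: continuous_subspaceT => x; apply: cvgM; first exact: continuous_horner.
    apply/differentiable_continuous/derivable1_diffP.
    by have [] := is_derive_gauss_dens x.
  - have cp x : {for x, continuous (fun x => p.[x] * gauss_dens x)}.
      apply/differentiable_continuous/derivable1_diffP.
      by have [] := is_derive_horner_gauss_dens p x.
    split => [x _||].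
    + by have [] := is_derive_horner_gauss_dens p x.
    + exact/cvg_at_right_filter/cp.
    + exact/cvg_at_left_filter/cp.
  - move=> x _; rewrite derive1E.
    by have D := is_derive_horner_gauss_dens p x; rewrite derive_val.
have lim1 : \int[gauss]_x (q.[x] * \1_(I n.+1) x) @[n --> \oo] --> gint q.
  apply: (Rintegral_dominated_cvg R gauss (gauss_integrable_expdom R) _ _ c).
  - by move=> n; exact: mqI.
  - move=> n x; rewrite normrM (le_trans _ (qc x)) // ler_piMr //.
    by rewrite indicE ger0_norm //; case: (_ \in _).
  - move=> x; apply: cvg_near_cst; near=> n.
    rewrite indicE mem_set ?mulr1 // /I /= in_itv /= -ler_norml.
    rewrite (@le_trans _ _ n%:R) ?ler_nat //.
    by near: n; exact: nbhs_infty_ger.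
have lim2 := horner_gauss_dens_cvg0 p.
rewrite -(cvg_shiftS (fun n => p.[n%:R] * gauss_dens n%:R - p.[- n%:R] * gauss_dens (- n%:R))) in lim2.
by rewrite -(cvg_lim _ lim1) // (funext intI); apply/cvg_lim.
Unshelve. all: by end_near. Qed.

(** Multiplication by [x] minus differentiation, which produces [hermp k.+1] from [hermp k], is the
    adjoint of differentiation for the Gaussian measure. *)
Lemma gint_hermpS k q : gint (hermp R k.+1 * q) = gint (hermp R k * q^`()).
Proof.
rewrite hermpS mulrBl gintB -mulrA gauss_ibp derivM gintD; ring.
Qed.

Lemma gint_hermpM k m : gint (hermp R k * hermp R m) = (k == m)%:R * k`!%:R.
Proof.
elim: k m => [|k IH] [|m].
- by rewrite /= mul1r gintC mulr1.
- by rewrite mulrC gint_hermpS /= derivC mulr0 -(scale0r 0) gintZ !mul0r.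
- by rewrite gint_hermpS /= derivC mulr0 -(scale0r 0) gintZ !mul0r.
- rewrite gint_hermpS deriv_hermp -scalerAr gintZ IH eqSS.
  by case: eqP => [->|_]; rewrite ?mul0r ?mulr0 // !mul1r factS natrM.
Qed.

End GaussianPolynomials.

(** Monotone convergence in the form that carries a uniform bound to the limit; it serves both for
    exponential moments and for removing the truncation of the density. *)
Lemma ge0_integral_le_lim d (T : measurableType d) (R : realType)
    (mu : {measure set T -> \bar R}) (g_ : nat -> T -> R) (g : T -> R) (K : \bar R) :
  (forall n, measurable_fun setT (g_ n)) -> (forall n x, 0 <= g_ n x) ->
  (forall x, {homo g_ ^~ x : n m / (n <= m)%N >-> n <= m}) ->
  (forall x, g_ n x @[n --> \oo] --> g x) ->
  (forall n, (\int[mu]_x (g_ n x)%:E <= K)%E) ->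
  (\int[mu]_x (g x)%:E <= K)%E.
Proof.
move=> mg g0 ndg gg gK.
have gE x : (g x)%:E = limn (fun n => (g_ n x)%:E).
  by apply/esym/cvg_lim => //; apply: cvg_EFin; [exact: nearW|exact: gg].
under eq_integral => x _ do rewrite gE.
rewrite (monotone_convergence mu measurableT (g' := fun n x => (g_ n x)%:E)).
- apply: lime_le; last exact: nearW.
  apply: ereal_nondecreasing_is_cvgn => n m nm.
  apply: ge0_le_integral => //; [by move=> x _; rewrite lee_fin| | |].
  + exact/measurable_EFinP.
  + exact/measurable_EFinP.
  + by move=> x _; rewrite lee_fin; exact: ndg.
- by move=> n; exact/measurable_EFinP.
- by move=> n x _; rewrite lee_fin.
- by move=> x _ n m nm; rewrite lee_fin; exact: ndg.
Qed.

(** * Upper bound for chi^2 *)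

Section QuadraticDomination.
Context (R : realType) (nu : probability (measurableTypeR R) R) (C : R).
Local Notation gauss := (normal_prob (0 : R) 1).
Hypothesis nu_poly : forall q : {poly R}, nu.-integrable setT (EFin \o horner q).
(* By AM-GM this follows from |nu(q) - gauss(q)| <= sqrt C |q|_(L^2(gauss)); unlike the
   latter it passes directly to dominated limits. *)
Hypothesis nu_le : forall q : {poly R},
  2 * (\int[nu]_x q.[x] - gint R q) <= C + gint R (q * q).

(* Taylor polynomial of 2 cosh(a x): its terms are nonnegative. *)
Definition cosh_poly (a : R) n : {poly R} :=
  \sum_(k < n) k`!%:R^-1 *: ((a *: 'X) ^+ k + (- a *: 'X) ^+ k).

Lemma horner_cosh_poly a n x : (cosh_poly a n).[x] =
  series (exp_coeff (a * x)) n + series (exp_coeff (- a * x)) n.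
Proof.
rewrite /cosh_poly horner_sum /series /= !big_mkord -big_split /=.
apply: eq_bigr => k _.
by rewrite hornerZ hornerD !horner_exp !hornerZ hornerX /exp_coeff /= mulrC mulrDl.
Qed.

Lemma cosh_poly_nd a x : {homo (fun n => (cosh_poly a n).[x]) : n m / (n <= m)%N >-> n <= m}.
Proof.
apply/nondecreasing_seqP => n; rewrite /cosh_poly big_ord_recr /= hornerD lerDl.
rewrite hornerZ hornerD !horner_exp !hornerZ hornerX mulr_ge0 ?invr_ge0 // mulNr exprNn.
rewrite -signr_odd; case: (boolP (odd n)) => no; first by rewrite expr1 mulN1r subrr.
by rewrite expr0 mul1r addr_ge0 // exprn_even_ge0.
Qed.

Lemma cosh_poly_ge0 a n x : 0 <= (cosh_poly a n).[x].
Proof.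
by have := cosh_poly_nd a x 0%N n isT; rewrite /cosh_poly big_ord0 horner0.
Qed.

Lemma cvg_cosh_poly a x :
  (cosh_poly a n).[x] @[n --> \oo] --> expR (a * x) + expR (- a * x).
Proof.
under eq_fun do rewrite horner_cosh_poly.
by apply: cvgD; exact: is_cvg_series_exp_coeff.
Qed.

Lemma cosh_poly_le a n x : (cosh_poly a n).[x] <= expdom R (`|a| + `|a| + 1) x.
Proof.
apply: le_trans (expdomD _ _ _ _ (normr_ge0 a) (normr_ge0 a)).
have H (b : R) : `|b| = `|a| -> series (exp_coeff (b * x)) n <= expdom R `|a| x.
  move=> ba; apply: (@le_trans _ _ (expR `|b * x|)); last first.
    by rewrite normrM ba ler_expR ler_wpM2l // lerDr.
  apply: le_trans (exp_partial_sum_le R (b * x) n); rewrite /series /=.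
  apply: ler_sum => k _; rewrite /exp_coeff /= ler_wpM2r ?invr_ge0 //.
  by rewrite -normrX ler_norm.
by rewrite horner_cosh_poly lerD // H // normrN.
Qed.

(** Applied to [cosh_poly c n], [nu_le] bounds the [nu]-integrals uniformly in [n], since the
    polynomials and their squares are dominated by Gaussian-integrable functions. Monotone
    convergence then makes [exp(c x) + exp(- c x)] integrable for [nu]. *)
Lemma nu_integrable_expdom c : nu.-integrable setT (EFin \o expdom R c).
Proof.
have m : measurable_fun setT (fun x : R => expR (c * x) + expR (- c * x)).
  by apply: measurable_funD; apply: measurableT_comp => //; exact: measurable_funM.
pose D := `|c| + `|c| + 1.
have key : (\int[nu]_x (expR (c * x) + expR (- c * x))%:E <=
    (\int[gauss]_x expdom R D x + (C + \int[gauss]_x expdom R (D + D) x) / 2)%:E)%E.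
  apply: (ge0_integral_le_lim _ _ _ nu (fun n => horner (cosh_poly c n))
    (fun x => expR (c * x) + expR (- c * x))).
  - by move=> n; exact: measurable_poly.
  - by move=> n x; exact: cosh_poly_ge0.
  - by move=> x; exact: cosh_poly_nd.
  - by move=> x; exact: cvg_cosh_poly.
  - move=> n; rewrite -(fineK (integrable_fin_num _ (nu_poly (cosh_poly c n)))) // lee_fin.
    have := nu_le (cosh_poly c n).
    have : gint R (cosh_poly c n) <= \int[gauss]_x expdom R D x.
      apply: le_Rintegral => //.
      - exact: gauss_integrable_horner.
      - exact: gauss_integrable_expdom.
      - by move=> x _; exact: cosh_poly_le.
    have : gint R (cosh_poly c n * cosh_poly c n) <= \int[gauss]_x expdom R (D + D) x.
      apply: le_Rintegral => //.
      - exact: gauss_integrable_horner.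
      - exact: gauss_integrable_expdom.
      - move=> x _; rewrite hornerM -expdomM.
        by rewrite ler_pM ?cosh_poly_ge0 ?cosh_poly_le.
    rewrite /Rintegral; lra.
have i : nu.-integrable setT (EFin \o (fun x : R => expR (c * x) + expR (- c * x))).
  apply/integrableP; split; first exact/measurable_EFinP.
  apply: (@le_lt_trans _ _ (\int[nu]_x (expR (c * x) + expR (- c * x))%:E)%E).
    rewrite le_eqVlt; apply/orP; left; apply/eqP; apply: eq_integral => x _ /=.
    by rewrite ger0_norm // addr_ge0 ?expR_ge0.
  by apply: le_lt_trans key _; rewrite ltry.
have i' := @integrableZl _ _ _ nu setT measurableT (expR `|c|) _ i.
apply: (le_integrable _ _ _ i') => //.
  by apply/measurable_EFinP; exact: measurable_expdom.
move=> x _; rewrite /= lee_fin [leLHS]ger0_norm ?expdom_ge0 //.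
rewrite [leRHS]ger0_norm ?mulr_ge0 ?addr_ge0 ?expR_ge0 //.
apply: (@le_trans _ _ (expdom R `|c| x)); first exact/le_expdom/ler_norm.
rewrite /expdom [_ * (1 + _)]mulrDr mulr1 expRD ler_pM2l ?expR_gt0 //.
rewrite -normrM; case: (ger0P (c * x)) => _; first by rewrite lerDl expR_ge0.
rewrite -mulNr lerDr; exact: expR_ge0.
Qed.

(** Once [nu] has exponential moments, each of the three integrals converges along a dominated
    limit; the square is dominated with constant [c + c]. *)
Lemma pclosure_quadratic g : pclosure R g ->
  2 * (\int[nu]_x g x - \int[gauss]_x g x) <= C + \int[gauss]_x (g x * g x).
Proof.
elim=> [q|g_ {}g c Pg_ IH gc gg].
  apply: le_trans (nu_le q) _; rewrite lerD2l le_eqVlt; apply/orP; left; apply/eqP.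
  by apply: eq_Rintegral => x _; rewrite hornerM.
have mg n := pclosure_measurable _ _ (Pg_ n).
have L1 := Rintegral_dominated_cvg R nu nu_integrable_expdom _ _ _ mg gc gg.
have L2 := Rintegral_dominated_cvg R gauss (gauss_integrable_expdom R) _ _ _ mg gc gg.
have L3 : \int[gauss]_x (g_ n x * g_ n x) @[n --> \oo] --> \int[gauss]_x (g x * g x).
  apply: (Rintegral_dominated_cvg R gauss (gauss_integrable_expdom R)
    (fun n x => g_ n x * g_ n x) _ (c + c)).
  - by move=> n; exact: measurable_funM.
  - by move=> n x; rewrite normrM -expdomM ler_pM.
  - by move=> x; apply: cvgM; exact: gg.
have H1 : 2 * (\int[nu]_x g_ n x - \int[gauss]_x g_ n x) @[n --> \oo] -->
    2 * (\int[nu]_x g x - \int[gauss]_x g x) by apply: cvgMl_tmp; exact: cvgB.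
have H2 : C + \int[gauss]_x (g_ n x * g_ n x) @[n --> \oo] -->
    C + \int[gauss]_x (g x * g x) by apply: cvgD => //; exact: cvg_cst.
by apply: (ler_cvg_to H1 H2); exact: nearW.
Qed.

Lemma quadratic_dominates : nu `<< gauss.
Proof.
apply/null_content_dominatesP => A mA A0.
have intA (mu : probability (measurableTypeR R) R) (t : R) :
    \int[mu]_x (t * \1_A x) = t * fine (mu A).
  rewrite RintegralZl //; last exact: integrable_indic.
  by rewrite /Rintegral integral_indic // setIT.
(* test function t * 1_A, with t arbitrarily large *)
have ineq t : 2 * (t * fine (nu A)) <= C.
  have := pclosure_quadratic _ (pclosureZ R t _ (pclosure_indic R A mA)).
  have -> : \int[gauss]_x (t * \1_A x * (t * \1_A x)) = \int[gauss]_x (t ^+ 2 * \1_A x).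
    by apply: eq_Rintegral => x _; rewrite indicE; case: (_ \in _); rewrite /=; ring.
  rewrite (intA nu) (intA gauss) (intA gauss).
  have -> : fine (gauss A) = 0 by rewrite (_ : gauss A = 0%E).
  by rewrite !mulr0 subr0 addr0.
have nA : (0 <= fine (nu A))%R by rewrite fine_ge0.
suff nA0 : fine (nu A) = 0.
  by rewrite -(fineK (fin_num_measure nu A mA)) nA0.
apply/eqP; rewrite eq_le nA andbT leNgt; apply/negP => pos.
have := ineq ((`|C| + 1) / fine (nu A)); rewrite divfK ?gt_eqF //.
have := ler_norm C; have := normr_ge0 C; lra.
Qed.

(** For a truncation [g] of [f - 1] one has [g (f - 1) = g^2], so [pclosure_quadratic] reads
    [2 gauss(g^2) <= C + gauss(g^2)]. As [gauss(g^2)] is finite this gives [gauss(g^2) <= C], and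
    the truncation is removed by monotone convergence. *)
Lemma quadratic_density : exists f : R -> R,
  [/\ measurable_fun setT f, (forall x, 0 <= f x),
      (forall A, measurable A -> nu A = (\int[gauss]_(x in A) (f x)%:E)%E) &
      (\int[gauss]_x ((f x - 1) ^+ 2)%:E <= C%:E)%E].
Proof.
have dom := quadratic_dominates.
pose F := Radon_Nikodym_SigmaFinite.f nu gauss.
pose f x := fine (F x).
have fE x : F x = (f x)%:E by rewrite fineK // (Radon_Nikodym_SigmaFinite.f_fin_num dom).
have mf : measurable_fun setT f.
  apply/measurable_EFinP.
  have := measurable_int _ (Radon_Nikodym_SigmaFinite.f_integrable dom).
  by apply: eq_measurable_fun => x _ /=; rewrite -fE.
have f0 x : 0 <= f x by rewrite fine_ge0 // (Radon_Nikodym_SigmaFinite.f_ge0 dom).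
have nuE A : measurable A -> nu A = (\int[gauss]_(x in A) (f x)%:E)%E.
  move=> mA; rewrite (Radon_Nikodym_SigmaFinite.f_integral dom mA).
  by apply: eq_integral => x _; rewrite -fE.
exists f; split => //.
pose B (M : nat) : set R := [set x | `|f x - 1| <= M%:R].
have mB M : measurable (B M).
  rewrite -[B M]setTI; apply: measurable_fun_le => //.
  by apply: measurableT_comp => //; exact: measurable_funB.
(* test functions: truncations of f - 1 *)
pose g M x := (f x - 1) * \1_(B M) x.
have mg M : measurable_fun setT (g M).
  apply: measurable_funM; first exact: measurable_funB.
  by apply: measurable_indic; exact: mB.
have gB M x : `|g M x| <= M%:R.
  rewrite /g indicE; case: (boolP (x \in B M)) => [/set_mem|_].
    by rewrite mulr1.
  by rewrite mulr0 normr0.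
have fi : gauss.-integrable setT (EFin \o f).
  have := Radon_Nikodym_SigmaFinite.f_integrable dom.
  by congr (_.-integrable _ _); apply/funext => x; exact: fE.
apply: (ge0_integral_le_lim _ _ _ gauss (fun M x => g M x ^+ 2)).
- by move=> M; exact: measurable_funX.
- by move=> M x; exact: sqr_ge0.
- move=> x M M' MM'; rewrite /g !exprMn ler_wpM2l ?sqr_ge0 // !indicE.
  case: (boolP (x \in B M)) => [/set_mem xB|_]; last by rewrite expr0n /= exprn_ge0.
  rewrite mem_set //= /B /=; apply: (le_trans xB); by rewrite ler_nat.
- move=> x; apply: cvg_near_cst; near=> M.
  rewrite /g indicE mem_set ?mulr1 // /B /=.
  by near: M; exact: nbhs_infty_ger.
- move=> M.
  have ng : nu.-integrable setT (EFin \o g M).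
    apply: (integrable_of_expdom R nu nu_integrable_expdom _ M%:R (mg M)) => x.
    by rewrite (le_trans (gB M x)) // ler_expdom.
  have gg : gauss.-integrable setT (EFin \o g M).
    apply: (integrable_of_expdom R gauss (gauss_integrable_expdom R) _ M%:R (mg M)) => x.
    by rewrite (le_trans (gB M x)) // ler_expdom.
  have ggg : gauss.-integrable setT (EFin \o (fun x => g M x ^+ 2)).
    apply: (integrable_of_expdom R gauss (gauss_integrable_expdom R) _ (M%:R + M%:R)) => [|x].
      exact: (measurable_funX 2 (mg M)).
    rewrite normrX expr2 -expdomM.
    by rewrite ler_pM // (le_trans (gB M x)) // ler_expdom.
  have ngE := Rintegral_density _ _ R nu gauss f mf f0 nuE _ ng.
  have gfi : gauss.-integrable setT (EFin \o (fun x => g M x * f x)).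
    exact/(integrable_density _ _ R nu gauss f mf f0 nuE _ (mg M)).
  have := pclosure_quadratic _ (pclosure_bounded R _ _ (mg M) (gB M)).
  rewrite ngE -RintegralB //.
  have -> : \int[gauss]_x (g M x * f x - g M x) = \int[gauss]_x (g M x ^+ 2).
    apply: eq_Rintegral => x _; rewrite /g indicE.
    by case: (_ \in _); rewrite /=; ring.
  have -> : \int[gauss]_x (g M x * g M x) = \int[gauss]_x (g M x ^+ 2).
    by apply: eq_Rintegral => x _; rewrite expr2.
  rewrite -(fineK (integrable_fin_num _ ggg)) // lee_fin /Rintegral /=; lra.
Unshelve. all: by end_near. Qed.

End QuadraticDomination.

(** * Hermite moments of a random variable and chi^2 *)

Section Chi2.
Context d (T : measurableType d) (R : realType) (P : probability T R).
Variable (Y : T -> R).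
Hypothesis mY : measurable_fun setT Y.
Local Notation gauss := (normal_prob (0 : R) 1).
Local Notation leb := (@lebesgue_measure R).

Let Ymix := isMeasurableFun.Build _ _ T (measurableTypeR R) Y mY.
Let Ym : {mfun T >-> measurableTypeR R} := HB.pack Y Ymix.
Let law := distribution P Ym.

Let integrable_law (g : R -> R) : measurable_fun setT g ->
  law.-integrable setT (EFin \o g) <-> P.-integrable setT (fun w => (g (Y w))%:E).
Proof.
move=> mg; have mEg : measurable_fun setT (EFin \o g) by exact/measurable_EFinP.
have E : (\int[law]_x `|(g x)%:E| = \int[P]_w `|(g (Y w))%:E|)%E.
  have mag : measurable_fun setT (abse \o (EFin \o g)).
    by apply: measurableT_comp => //; exact/measurable_EFinP.
  by apply: (@ge0_integral_distribution _ _ _ _ _ P Ym _ mag) => y; exact: abse_ge0.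
split => /integrableP[_ h]; apply/integrableP; split => //.
- by apply/measurable_EFinP; exact: measurableT_comp.
- by rewrite -E.
- by rewrite /= E.
Qed.

Let Rintegral_law (g : R -> R) : measurable_fun setT g ->
  P.-integrable setT (fun w => (g (Y w))%:E) ->
  \int[law]_x g x = \int[P]_w g (Y w).
Proof.
move=> mg gi; congr fine.
have mEg : measurable_fun setT (EFin \o g) by exact/measurable_EFinP.
exact: (@integral_distribution _ _ _ _ _ P Ym _ mEg gi).
Qed.

Definition hmom m : R := \int[P]_w (nherm R m).[Y w].

Lemma chi2_ge0 : (0 <= chi2 P Y)%E.
Proof.
apply: le_ereal_inf_tmp => _ [p [_ ->]]; apply: integral_ge0 => x _.
by rewrite lee_fin mulr_ge0 ?sqr_ge0 ?gauss_dens_ge0.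
Qed.

Lemma gint_nhermM k m : gint R (nherm R k * nherm R m) = (k == m)%:R / k`!%:R.
Proof.
have f0 : k`!%:R != 0 :> R by rewrite pnatr_eq0 -lt0n fact_gt0.
have -> : nherm R k * nherm R m = (k`!%:R^-1 / m`!%:R) *: (hermp R k * hermp R m).
  by rewrite /nherm -scalerAl -scalerAr scalerA.
rewrite gintZ gint_hermpM; case: eqP => [<-|_]; last by rewrite !mul0r mulr0.
by rewrite mul1r mulfVK // div1r.
Qed.

Lemma gint_sum_sqr M (c : nat -> R) :
  gint R ((\sum_(m < M) c m *: nherm R m) * (\sum_(m < M) c m *: nherm R m)) =
  \sum_(m < M) c m ^+ 2 / m`!%:R.
Proof.
rewrite mulr_suml gint_sum; apply: eq_bigr => i _.
rewrite mulr_sumr gint_sum (bigD1 i) //= big1 => [|j ji].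
  by rewrite addr0 -scalerAl -scalerAr !gintZ gint_nhermM eqxx mulrA expr2 div1r.
rewrite -scalerAl -scalerAr !gintZ gint_nhermM.
by rewrite (_ : (_ == _) = false) ?mul0r ?mulr0 //; apply/eqP => /ord_inj/esym; apply/eqP.
Qed.

Lemma gint_nherm m : gint R (nherm R m) = (m == 0)%:R.
Proof.
have := gint_hermpM R m 0; rewrite {2}/hermp mulr1 /nherm gintZ => ->.
by case: m => [|m]; rewrite /= ?mul0r ?mulr0 // invr1 !mul1r.
Qed.

Section Upper.
Variable C : R.
Hypothesis Ypoly : forall q : {poly R}, P.-integrable setT (fun w => (q.[Y w])%:E).

Lemma lincomb_hmom M (c : nat -> R) :
  \int[P]_w (\sum_(m < M) c m *: nherm R m).[Y w] = \sum_(m < M) c m * hmom m.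
Proof.
elim: M => [|M IH].
  rewrite !big_ord0; under eq_Rintegral do rewrite horner0.
  by rewrite Rintegral_cst // mul0r.
rewrite !big_ord_recr /= -IH /hmom -RintegralZl //; last exact: Ypoly.
rewrite -RintegralD //; last 2 first.
- exact: Ypoly.
- by have := Ypoly (c M *: nherm R M); congr (_.-integrable _ _);
    apply/funext => w /=; rewrite hornerZ.
by apply: eq_Rintegral => w _; rewrite hornerD hornerZ.
Qed.

Lemma hmom0 : hmom 0 = 1.
Proof.
rewrite /hmom; under eq_Rintegral do rewrite nherm0 hornerC.
by rewrite Rintegral_cst // mul1r -[RHS]/(fine 1%E) -(@probability_setT _ _ _ P).
Qed.

Hypothesis Ysum : forall M, \sum_(1 <= m < M) m`!%:R * hmom m ^+ 2 <= C.

(** Expanding [q] in the [nherm m], the constant terms cancel on the left, and for [m >= 1] the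
    inequality [2 c u <= m! u^2 + c^2 / m!] gives the hypothesis of [quadratic_density]. The density
    [f] relative to [gauss] becomes [f * gauss_dens] relative to Lebesgue measure. *)
Lemma chi2_le : (chi2 P Y <= C%:E)%E.
Proof.
have law_poly q : law.-integrable setT (EFin \o horner q).
  by apply/integrable_law => //; exact: measurable_poly.
have lawE q : \int[law]_x q.[x] = \int[P]_w q.[Y w].
  by apply: Rintegral_law => //; exact: measurable_poly.
have law_le (q : {poly R}) : 2 * (\int[law]_x q.[x] - gint R q) <= C + gint R (q * q).
  (* One term more than the size of [q], so that the term [m = 0] can be split off even when
     [q = 0]. *)
  have [c qE] : exists c : nat -> R, q = \sum_(m < (size q).+1) c m *: nherm R m.
    have [c cE] := hermp_span R (size q).+1 q (leqnSn _).
    exists (fun m => c m * m`!%:R); rewrite {1}cE; apply: eq_bigr => m _.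
    by rewrite hermp_nherm scalerA.
  set M := size q in qE.
  have -> : gint R q = c 0%N.
    rewrite qE gint_sum big_ord_recl /= gintZ gint_nherm mulr1 big1 ?addr0 // => i _.
    by rewrite gintZ gint_nherm mulr0.
  have -> : \int[law]_x q.[x] = \sum_(m < M.+1) c m * hmom m.
    by rewrite lawE {1}qE lincomb_hmom.
  rewrite {1 2}qE gint_sum_sqr !big_ord_recl /= hmom0.
  have := Ysum M.+1; rewrite big_add1 /= big_mkord => YM.
  have : \sum_(i < M) (2 * (c (bump 0 i) * hmom (bump 0 i))) <=
     \sum_(i < M) (i.+1`!%:R * hmom i.+1 ^+ 2 + c (bump 0 i) ^+ 2 / (bump 0 i)`!%:R).
    apply: ler_sum => i _; rewrite /bump /= add1n.
    have f0 : 0 < i.+1`!%:R :> R by rewrite ltr0n fact_gt0.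
    have f1 : i.+1`!%:R * i.+1`!%:R^-1 = 1 :> R by rewrite divff // gt_eqF.
    have := mulr_ge0 (ltW f0) (sqr_ge0 (hmom i.+1 - c i.+1 / i.+1`!%:R)).
    move: (hmom _) (c _) (_`!%:R) (_^-1) f1 => u v a b f1.
    have -> : a * (u - v * b) ^+ 2 = a * u ^+ 2 - 2 * (v * u) * (a * b) + v ^+ 2 * b * (a * b).
      by ring.
    by rewrite f1 => ?; lra.
  rewrite big_split /= -mulr_sumr.
  by have := sqr_ge0 (c 0%N); rewrite invr1; lra.
have [f [mf f0 lawf fC]] := quadratic_density R law C law_poly law_le.
pose p x := f x * gauss_dens x.
have mp : measurable_fun setT p.
  by apply: measurable_funM => //; exact: measurable_gauss_dens.
have pE x : (p x / gauss_dens x - 1) ^+ 2 * gauss_dens x = (f x - 1) ^+ 2 * gauss_dens x.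
  by rewrite /p mulfK // gt_eqF // gauss_dens_gt0.
apply: ereal_inf_le; exists (\int[leb]_x (((p x / gauss_dens x - 1) ^+ 2 * gauss_dens x)%:E))%E.
  exists p; split => //; split => //.
    by move=> x; rewrite mulr_ge0 // gauss_dens_ge0.
  move=> A mA.
  have -> : P (Y @^-1` A) = (\int[gauss]_(x in A) (f x)%:E)%E by exact: (lawf A mA).
  rewrite integral_mkcond ge0_integral_gauss.
  - rewrite [RHS]integral_mkcond; apply: eq_integral => x _.
    rewrite !patchE; case: ifP => _; last by rewrite mul0e.
    by rewrite EFinM.
  - apply/(measurable_restrictT _ mA)/measurable_funTS; exact/measurable_EFinP.
  - by move=> x; rewrite patchE; case: ifP => _ //; rewrite lee_fin.
apply: le_trans fC; rewrite ge0_integral_gauss; last 2 first.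
- by apply/measurable_EFinP; apply: measurable_funX; exact: measurable_funB.
- by move=> x; rewrite lee_fin sqr_ge0.
rewrite le_eqVlt; apply/orP; left; apply/eqP; apply: eq_integral => x _.
by rewrite pE EFinM.
Qed.
End Upper.

(** * Bessel's inequality for chi^2 *)

Section Bessel.
Variable p : R -> R.
Hypothesis Yp : is_density P Y p.
Let f x := p x / gauss_dens x.
Hypothesis fin : (\int[leb]_x ((f x - 1) ^+ 2 * gauss_dens x)%:E < +oo)%E.

Let mp : measurable_fun setT p. Proof. by case: Yp. Qed.
Let p0 x : 0 <= p x. Proof. by case: Yp. Qed.
Let lawp A : measurable A -> law A = (\int[leb]_(x in A) (p x)%:E)%E.
Proof. by case: Yp => _ _; apply. Qed.

Let mf : measurable_fun setT f.
Proof.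
apply: measurable_funM => //.
have -> : (fun x : R => (gauss_dens x)^-1) =
    (fun x => Num.sqrt (2 * pi) * expR (x ^+ 2 / 2)).
  by apply/funext => x; rewrite /gauss_dens invf_div mulNr expRN invrK mulrC.
apply: measurable_funM => //; apply: measurableT_comp => //.
by apply: measurable_funM => //; exact: measurable_funX.
Qed.

Let pE x : f x * gauss_dens x = p x.
Proof. by rewrite /f divfK // gt_eqF // gauss_dens_gt0. Qed.

Let m2 : measurable_fun setT (fun x => (f x - 1) ^+ 2).
Proof. by apply: measurable_funX; exact: measurable_funB. Qed.

Lemma integrable_relative_density_sqr :
  gauss.-integrable setT (EFin \o (fun x => (f x - 1) ^+ 2)).
Proof.
apply/(integrable_gauss _ _ m2)/integrableP; split.
  apply/measurable_EFinP; apply: measurable_funM => //.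
  exact: measurable_gauss_dens.
apply: le_lt_trans fin; rewrite le_eqVlt; apply/orP; left; apply/eqP.
apply: eq_integral => x _.
by rewrite gee0_abs // lee_fin mulr_ge0 ?sqr_ge0 ?gauss_dens_ge0.
Qed.

(** Both factors are square integrable for [gauss]. This is how a finite chi^2 yields all polynomial
    moments of [Y]. *)
Lemma integrable_horner_relative (q : {poly R}) :
  gauss.-integrable setT (EFin \o (fun x => q.[x] * (f x - 1))).
Proof.
have i2 := integrable_relative_density_sqr.
have iq := gauss_integrable_horner R (q * q).
apply: (le_integrable _ _ _ (integrableD measurableT iq i2)) => //.
  apply/measurable_EFinP; apply: measurable_funM; first exact: measurable_poly.
  exact: measurable_funB.
move=> x _ /=; rewrite lee_fin hornerM [leRHS]ger0_norm; last first.
  by rewrite addr_ge0 ?sqr_ge0 // -expr2 sqr_ge0.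
rewrite ler_norml; have := sqr_ge0 (q.[x] - (f x - 1)).
by have := sqr_ge0 (q.[x] + (f x - 1)); rewrite !expr2; nra.
Qed.

Lemma integrable_horner_density (q : {poly R}) :
  gauss.-integrable setT (EFin \o (fun x => q.[x] * f x)).
Proof.
have := integrableD measurableT (integrable_horner_relative q) (gauss_integrable_horner R q).
congr (_.-integrable _ _); apply/funext => x /=; congr EFin; ring.
Qed.

Let law_integrable_horner (q : {poly R}) : law.-integrable setT (EFin \o horner q).
Proof.
have mq : measurable_fun setT (horner q) by exact: measurable_poly.
apply/(integrable_density _ _ R law leb p mp p0 lawp _ mq).
have mqf : measurable_fun setT (fun x => q.[x] * f x) by apply: measurable_funM.
have /(integrable_gauss _ _ mqf) := integrable_horner_density q.
by congr (_.-integrable _ _); apply/funext => x; rewrite -mulrA pE.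
Qed.

Lemma density_integrable_horner (q : {poly R}) : P.-integrable setT (fun w => (q.[Y w])%:E).
Proof.
have mq : measurable_fun setT (horner q) by exact: measurable_poly.
by apply/(integrable_law _ mq); exact: law_integrable_horner.
Qed.

(** The polynomial [q] is the orthogonal projection of [f - 1] onto the span of the [nherm m] with
    [1 <= m <= M]. Both [gauss(q (f - 1))] and [gauss(q^2)] equal the sum [S], and
    [2 q (f - 1) <= q^2 + (f - 1)^2] is integrated. *)
Lemma density_bessel M :
  ((\sum_(1 <= m < M) m`!%:R * hmom m ^+ 2)%:E <=
   \int[leb]_x ((f x - 1) ^+ 2 * gauss_dens x)%:E)%E.
Proof.
case: M => [|M].
  rewrite big_geq // integral_ge0 // => x _.
  by rewrite lee_fin mulr_ge0 ?sqr_ge0 ?gauss_dens_ge0.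
set S := \sum_(_ <= _ < _) _.
(* The coefficient at [0] vanishes because [f - 1] has Gaussian mean [0]. *)
pose c m : R := if m is 0 then 0 else m`!%:R * hmom m.
pose q : {poly R} := \sum_(m < M.+1) c m *: nherm R m.
have SE : S = \sum_(i < M) (i.+1)`!%:R * hmom i.+1 ^+ 2.
  by rewrite /S big_add1 /= big_mkord.
have E1 : \int[gauss]_x (q.[x] * f x) = S.
  rewrite Rintegral_gauss; last exact: integrable_horner_density.
  under eq_Rintegral do rewrite -mulrA pE.
  rewrite -(Rintegral_density _ _ R law leb p mp p0 lawp _ (law_integrable_horner q)).
  rewrite Rintegral_law; [|exact: measurable_poly|exact: density_integrable_horner].
  rewrite lincomb_hmom; last exact: density_integrable_horner.
  rewrite big_ord_recl mul0r add0r SE; apply: eq_bigr => i _.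
  by rewrite /c /= /bump /= add1n expr2 mulrA.
have E2 : gint R q = 0.
  rewrite gint_sum big_ord_recl scale0r -(scale0r 0) gintZ mul0r add0r big1 // => i _.
  by rewrite gintZ gint_nherm mulr0.
have E3 : gint R (q * q) = S.
  rewrite gint_sum_sqr big_ord_recl /= expr0n /= mul0r add0r SE; apply: eq_bigr => i _.
  rewrite /bump /= add1n exprMn.
  by rewrite mulrAC [_`!%:R ^+ 2]expr2 mulfK // pnatr_eq0 -lt0n fact_gt0.
have E4 : \int[gauss]_x (q.[x] * (f x - 1)) = S.
  transitivity (\int[gauss]_x (q.[x] * f x) - \int[gauss]_x q.[x]).
    2: by rewrite E1 -/(gint R q) E2 subr0.
  rewrite -RintegralB //; last 2 first.
  - exact: integrable_horner_density.
  - exact: gauss_integrable_horner.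
  by apply: eq_Rintegral => x _; rewrite mulrBr mulr1.
have E5 : (\int[leb]_x ((f x - 1) ^+ 2 * gauss_dens x)%:E = (\int[gauss]_x (f x - 1) ^+ 2)%:E)%E.
  rewrite /Rintegral fineK; last exact: integrable_fin_num integrable_relative_density_sqr.
  rewrite ge0_integral_gauss //; first exact/measurable_EFinP.
  by move=> x; rewrite lee_fin sqr_ge0.
rewrite E5 lee_fin.
have : 2 * \int[gauss]_x (q.[x] * (f x - 1)) <=
    \int[gauss]_x ((q * q).[x] + (f x - 1) ^+ 2).
  rewrite -RintegralZl //; last exact: integrable_horner_relative.
  apply: le_Rintegral => //.
  - have := integrableZl measurableT 2 (integrable_horner_relative q).
    by congr (_.-integrable _ _).
  - exact: (integrableD measurableT (gauss_integrable_horner R (q * q)) integrable_relative_density_sqr).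
  - by move=> x _; rewrite hornerM; have := sqr_ge0 (q.[x] - (f x - 1)); rewrite !expr2; lra.
rewrite RintegralD //; last 2 first.
- exact: gauss_integrable_horner.
- exact: integrable_relative_density_sqr.
by rewrite E4 -/(gint R (q * q)) E3 mulr_natl mulr2n lerD2l.
Qed.

End Bessel.

Lemma chi2_lty_integrable_horner : (chi2 P Y < +oo)%E ->
  forall q : {poly R}, P.-integrable setT (fun w => (q.[Y w])%:E).
Proof.
move=> /ereal_inf_lt[_ [p [Yp ->]] fin] q; exact: (density_integrable_horner p Yp fin q).
Qed.

Lemma chi2_bessel M : ((\sum_(1 <= m < M) m`!%:R * hmom m ^+ 2)%:E <= chi2 P Y)%E.
Proof.
apply: le_ereal_inf_tmp => _ [p [Yp ->]].
have [->|] := eqVneq (\int[leb]_x ((p x / gauss_dens x - 1) ^+ 2 * gauss_dens x)%:E)%E +oo%E.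
  exact: leey.
rewrite -ltey => fin.
exact: (density_bessel p Yp fin M).
Qed.

End Chi2.

(** * Independence *)

Section IndependentPair.
Context d (T : measurableType d) (R : realType) (P : probability T R).

Definition independent_pair (U V : T -> R) := forall A B : set R,
  measurable A -> measurable B ->
  P (U @^-1` A `&` V @^-1` B) = (P (U @^-1` A) * P (V @^-1` B))%E.

Variables (U V : T -> R).
Hypotheses (mU : measurable_fun setT U) (mV : measurable_fun setT V).
Hypothesis UV : independent_pair U V.

Let Umix := isMeasurableFun.Build _ _ T (measurableTypeR R) U mU.
Let Um : {mfun T >-> measurableTypeR R} := HB.pack U Umix.
Let Vmix := isMeasurableFun.Build _ _ T (measurableTypeR R) V mV.
Let Vm : {mfun T >-> measurableTypeR R} := HB.pack V Vmix.
Let W w : measurableTypeR R * measurableTypeR R := (U w, V w).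
Let mW : measurable_fun setT W.
Proof. exact: (measurable_fun_pair (T1 := measurableTypeR R) (T2 := measurableTypeR R) mU mV). Qed.
Let Wmix := isMeasurableFun.Build _ _ T _ W mW.
Let Wm : {mfun T >-> (measurableTypeR R * measurableTypeR R)%type} := HB.pack W Wmix.
Let lU := distribution P Um.
Let lV := distribution P Vm.
Let lW := distribution P Wm.

(** Independence says that the joint law and the product of the marginals agree on rectangles, which
    determines the product measure. *)
Let lWE A : measurable A -> lW A = (lU \x lV)%E A.
Proof.
move=> mA; apply/esym.
have H := @product_measure_unique _ _ _ _ _ lU lV lW.
by apply: H => // A1 A2 mA1 mA2; exact: UV.
Qed.

Lemma expectation_prod_independent (f g : R -> R) :
  measurable_fun setT f -> measurable_fun setT g ->
  P.-integrable setT (fun w => (f (U w))%:E) ->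
  P.-integrable setT (fun w => (g (V w))%:E) ->
  P.-integrable setT (fun w => (f (U w) * g (V w))%:E) ->
  \int[P]_w (f (U w) * g (V w)) = (\int[P]_w f (U w)) * (\int[P]_w g (V w)).
Proof.
move=> mf mg fi gi fgi.
have mfE : measurable_fun setT (EFin \o f) by exact/measurable_EFinP.
have mgE : measurable_fun setT (EFin \o g) by exact/measurable_EFinP.
pose F (z : measurableTypeR R * measurableTypeR R) := (f z.1 * g z.2)%:E.
have mF : measurable_fun setT F.
  apply/measurable_EFinP; apply: measurable_funM.
    exact: (measurableT_comp mf (@measurable_fst _ _ _ _)).
  exact: (measurableT_comp mg (@measurable_snd _ _ _ _)).
have iF : lW.-integrable setT F.
  by apply: integrable_pushforward.
have E1 : (\int[P]_w (f (U w) * g (V w))%:E = \int[lW]_z F z)%E.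
  by rewrite (@integral_distribution _ _ _ _ _ P Wm F mF fgi).
have ii : (lU \x lV)%E.-integrable setT F.
  apply/integrableP; split => //; case/integrableP : iF => _.
  by rewrite (eq_measure_integral (lU \x lV)%E) // => A mA _; exact: lWE.
have E2 : (\int[lW]_z F z = \int[(lU \x lV)%E]_z F z)%E.
  by apply: eq_measure_integral => A mA _; exact: lWE.
have ifU : lU.-integrable setT (EFin \o f) by apply: integrable_pushforward.
have igV : lV.-integrable setT (EFin \o g) by apply: integrable_pushforward.
have EU : (\int[lU]_x (f x)%:E = \int[P]_w (f (U w))%:E)%E.
  by rewrite (@integral_distribution _ _ _ _ _ P Um _ mfE fi).
have EV : (\int[lV]_x (g x)%:E = \int[P]_w (g (V w))%:E)%E.
  by rewrite (@integral_distribution _ _ _ _ _ P Vm _ mgE gi).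
rewrite /Rintegral E1 E2 -integral12_prod_meas1 // /fubini_F /F /=.
have -> : (\int[lU]_x \int[lV]_y (f x * g y)%:E =
    \int[lU]_x ((f x)%:E * \int[lV]_y (g y)%:E))%E.
  apply: eq_integral => x _; rewrite -integralZl //.
rewrite EV -[X in (\int[lU]_x (_ * X))%E]fineK; last exact: integrable_fin_num.
rewrite integralZr // EU fineM //; exact: integrable_fin_num.
Qed.

End IndependentPair.

(** * Independence of one variable from the sum of the others *)

Section MutualIndependence.
Context d (T : measurableType d) (R : realType) (P : probability T R).
Context (n : nat) (X : 'I_n -> T -> R).
Hypothesis mX : forall j, measurable_fun setT (X j).
Hypothesis indX : mutually_independent P X.

Lemma mutually_independent_pair (k : 'I_n) :
  independent_pair _ _ _ P (X k) (fun w => (\sum_(j < n | j != k) X j w) / Num.sqrt (n%:R - 1)).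
Proof.
move=> A B mA mB.
(* The events defined by the X_j, j <> k: S_(n;k) is measurable with respect to the
   sigma-algebra they generate, on which independence from X_k extends by Dynkin. *)
pose rect (C : 'I_n -> set R) := [set w | forall j, C j (X j w)].
(* The condition [C k = setT] means that the rectangle puts no constraint on [X k]. *)
pose G := [set E | exists2 C, (forall j, measurable (C j)) & C k = setT /\ E = rect C].
pose T' := g_sigma_algebraType G.
have mrect C : (forall j, measurable (C j)) -> measurable (rect C).
  move=> mC; have -> : rect C = \bigcap_(j in [set: 'I_n]) (X j @^-1` C j).
    by apply/seteqP; split => w h j //; [move=> _; exact: h|exact: h].
  apply: fin_bigcap_measurable => // j _.
  by rewrite -[X in measurable X]setTI; exact: mX.
have G_measurable : <<s G >> `<=` measurable.
  apply: smallest_sub; first exact: sigma_algebra_measurable.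
  by move=> _ [C mC [_ ->]]; exact: mrect.
have mXA : measurable (X k @^-1` A) by rewrite -[X in measurable X]setTI; exact: mX.
have key : forall S, <<s G >> S -> P (X k @^-1` A `&` S) = (P (X k @^-1` A) * P S)%E.
  apply: (@dynkin_induction _ T' G
    (fun S => P (X k @^-1` A `&` S) = (P (X k @^-1` A) * P S)%E)) => //.
  - move=> _ _ [C mC [Ck ->]] [D mD [Dk ->]].
    exists (fun j => C j `&` D j); first by move=> j; exact: measurableI.
    split; first by rewrite Ck Dk setTI.
    by apply/seteqP; split => w /= => [[h1 h2] j|h]; split => // j; case: (h j).
  - by rewrite setIT probability_setT mule1.
  - move=> _ [C mC [Ck ->]].
    (* Putting [A] into the free slot [k] turns the intersection into a single rectangle, to which
       [indX] applies. *)
    pose C' j := if j == k then A else C j.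
    have mC' j : measurable (C' j) by rewrite /C'; case: ifP.
    have -> : X k @^-1` A `&` rect C = rect C'.
      apply/seteqP; split => w /= => [[h1 h2] j|h].
        by rewrite /C'; case: eqP => [->|_] //; exact: h2.
      split; first by have := h k; rewrite /C' eqxx.
      by move=> j; have := h j; rewrite /C'; case: eqP => [-> _|//]; rewrite Ck.
    rewrite /rect !indX // (bigD1 k) //= [in RHS](bigD1 k) //= Ck /C' eqxx.
    rewrite preimage_setT probability_setT mul1e; congr (_ * _)%E.
    by apply: eq_bigr => j jk; rewrite (negbTE jk).
  - move=> S mS PS.
    have {}mS : d.-measurable (S : set T) := G_measurable S mS.
    have E1 : P (X k @^-1` A) =
        (P (X k @^-1` A `&` S) + P (X k @^-1` A `&` ~` S))%E.
      rewrite -measureU ?setIUr //.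
      + by rewrite -setIUr setUv setIT.
      + exact: measurableI.
      + by apply: measurableI => //; exact: measurableC.
      + by rewrite setIACA setICr setI0.
    rewrite probability_setC // muleBr ?fin_num_measure // mule1 -PS {1}E1 addeAC subee ?add0e //.
    by rewrite fin_num_measure //; exact: measurableI.
  - move=> F mF tF PF.
    rewrite setI_bigcupr measure_bigcup //; last 2 first.
      + by move=> i _; apply: measurableI => //; apply: G_measurable; exact: mF.
      + by apply: trivIset_setIl.
    rewrite measure_bigcup //; last first.
      + by move=> i _; apply: G_measurable; exact: mF.
    rewrite -[P (X k @^-1` A)]fineK ?fin_num_measure // -nneseriesZl ?fine_ge0 //.
    by apply: eq_eseriesr => i _; rewrite fineK ?fin_num_measure //; exact: PF.
have mXj j : j != k -> measurable_fun setT (X j : T' -> R).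
  move=> jk _ D mD; rewrite setTI; apply: sub_sigma_algebra.
  (* A preimage under [X j] is itself a generator, since [j != k] leaves slot [k] free. *)
  exists (fun i => if i == j then D else setT); first by move=> i; case: ifP.
  split; first by rewrite eq_sym (negbTE jk).
  apply/seteqP; split => w /= => [h i|h].
    by case: eqP => [->|].
  by have := h j; rewrite eqxx.
apply: key.
have mV : measurable_fun setT
    ((fun w => (\sum_(j < n | j != k) X j w) / Num.sqrt (n%:R - 1)) : T' -> R).
  apply: measurable_funM => //.
  have -> : (fun w : T' => \sum_(j < n | j != k) X j w) =
      (fun w => \sum_(j < n) (if j != k then X j w else 0)).
    by apply/funext => w; rewrite big_mkcond.
  apply: measurable_sum => j; case: (boolP (j != k)) => [jk|_]; last exact: measurable_cst.
  exact: mXj.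
by have := mV measurableT _ mB; rewrite setTI.
Qed.

End MutualIndependence.

(** * Proof of the main inequality *)

Section FiniteSums.
Variable R : realType.

(** The weights are absorbed as square roots; the rest is Lagrange's identity. *)
Lemma sum_cauchy_schwarz N (rho x y : 'I_N -> R) : (forall i, 0 < rho i) ->
  (\sum_i x i * y i) ^+ 2 <= (\sum_i rho i * x i ^+ 2) * (\sum_i y i ^+ 2 / rho i).
Proof.
move=> r0; pose a i := Num.sqrt (rho i) * x i; pose b i := y i / Num.sqrt (rho i).
have s0 i : Num.sqrt (rho i) != 0 by rewrite gt_eqF // sqrtr_gt0.
have -> : \sum_i x i * y i = \sum_i a i * b i.
  by apply: eq_bigr => i _; rewrite /a /b; field.
have -> : \sum_i rho i * x i ^+ 2 = \sum_i a i ^+ 2.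
  by apply: eq_bigr => i _; rewrite /a exprMn sqr_sqrtr // ltW.
have -> : \sum_i y i ^+ 2 / rho i = \sum_i b i ^+ 2.
  by apply: eq_bigr => i _; rewrite /b exprMn exprVn sqr_sqrtr // ltW.
have lagrange : 0 <= \sum_i \sum_j (a i * b j - a j * b i) ^+ 2.
  by apply: sumr_ge0 => i _; apply: sumr_ge0 => j _; exact: sqr_ge0.
have E : \sum_i \sum_j (a i * b j - a j * b i) ^+ 2 =
    2 * ((\sum_i a i ^+ 2) * (\sum_i b i ^+ 2)) - 2 * (\sum_i a i * b i) ^+ 2.
  transitivity ((\sum_i a i ^+ 2) * (\sum_i b i ^+ 2) + (\sum_i b i ^+ 2) * (\sum_i a i ^+ 2)
      - 2 * ((\sum_i a i * b i) * (\sum_i a i * b i))); last by rewrite expr2; ring.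
  rewrite !big_distrlr /= mulr_sumr -big_split -sumrB; apply: eq_bigr => i _ /=.
  rewrite mulr_sumr -big_split -sumrB; apply: eq_bigr => j _ /=; ring.
by rewrite E in lagrange; lra.
Qed.

Lemma sqr_sum_le N (x : 'I_N -> R) : (\sum_i x i) ^+ 2 <= N%:R * \sum_i x i ^+ 2.
Proof.
have := sum_cauchy_schwarz N (fun=> 1) x (fun=> 1) (fun=> ltr01).
under eq_bigr do rewrite mulr1.
under [X in _ <= X * _]eq_bigr do rewrite mul1r.
under [X in _ <= _ * X]eq_bigr do rewrite expr1n divr1.
by rewrite sumr_const card_ord mulrC.
Qed.

(** Both sides run over the triangle [j + s < M]. *)
Lemma sum_antidiagonal M (F : nat -> nat -> R) :
  \sum_(m < M) \sum_(j < m.+1) F j (m - j)%N = \sum_(j < M) \sum_(s < M - j) F j s.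
Proof.
elim: M => [|M IH]; first by rewrite !big_ord0.
rewrite big_ord_recr /= IH [RHS]big_ord_recr /= subSn // subnn big_ord1.
rewrite [X in _ + X]big_ord_recr /= subnn addrA -big_split /=; congr (_ + _).
by apply: eq_bigr => j _; rewrite subSn ?big_ord_recr //= ltnW.
Qed.

End FiniteSums.

(** * Integrability of polynomials in random variables *)

Section Integrals.
Context d (T : measurableType d) (R : realType) (P : probability T R).

Lemma integrable_Rintegral_sum I (s : seq I) (F : I -> T -> R) :
  (forall i, P.-integrable setT (EFin \o F i)) ->
  P.-integrable setT (EFin \o (fun w => \sum_(i <- s) F i w)) /\
  \int[P]_w (\sum_(i <- s) F i w) = \sum_(i <- s) \int[P]_w F i w.
Proof.
move=> iF; elim: s => [|i s [IH1 IH2]].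
  split.
    have := integrable0 P setT.
    by congr (_.-integrable _ _); apply/funext => w; rewrite /= big_nil.
  under eq_Rintegral do rewrite big_nil.
  by rewrite Rintegral_cst // mul0r big_nil.
split.
  have := integrableD measurableT (iF i) IH1.
  by congr (_.-integrable _ _); apply/funext => w; rewrite /= big_cons.
under eq_Rintegral do rewrite big_cons.
by rewrite RintegralD // IH2 big_cons.
Qed.

Lemma measurable_horner_comp (U : T -> R) (q : {poly R}) :
  measurable_fun setT U -> measurable_fun setT (fun w => q.[U w]).
Proof.
move=> mU; have mq : measurable_fun setT (horner q) by exact: measurable_poly.
exact: measurableT_comp mq mU.
Qed.

Definition poly_integrable (U : T -> R) :=
  forall q : {poly R}, P.-integrable setT (EFin \o (fun w => q.[U w])).

(** The spanning family is arbitrary because two are used: the monomials, and the [hermp k] when [J]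
    contains all positive integers. *)
Lemma poly_integrable_spanned (U : T -> R) (b : nat -> {poly R}) :
  (forall N (q : {poly R}), (size q <= N)%N ->
     exists c : nat -> R, q = \sum_(i < N) c i *: b i) ->
  (forall k, P.-integrable setT (EFin \o (fun w => (b k).[U w]))) ->
  poly_integrable U.
Proof.
move=> span bi q; have [c qE] := span _ q (leqnn _).
have [|+ _] := integrable_Rintegral_sum _ (index_enum 'I_(size q)) (fun i w => c i * (b i).[U w]).
  move=> i; have := integrableZl measurableT (c i) (bi i).
  by congr (_.-integrable _ _).
congr (_.-integrable _ _); apply/funext => w /=; rewrite [in RHS]qE horner_sum.
by congr EFin; apply: eq_bigr => i _; rewrite hornerZ.
Qed.

Lemma poly_integrable_pow (U : T -> R) : measurable_fun setT U ->
  (forall k, P.-integrable setT (EFin \o (fun w => `|U w| ^+ k))) -> poly_integrable U.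
Proof.
move=> mU ik; apply: (poly_integrable_spanned _ (fun k => 'X^k)) => [N q sq|k].
  exists (fun i => q`_i); apply/polyP => i.
  rewrite coef_sum; case: (ltnP i N) => iN.
    rewrite (bigD1 (Ordinal iN)) //= coefZ coefXn eqxx mulr1 big1 ?addr0 // => j ji.
    by rewrite coefZ coefXn (_ : (_ == _) = false) ?mulr0 //; apply/negbTE;
      apply: contra ji => /eqP ij; apply/eqP/val_inj.
  rewrite nth_default ?(leq_trans sq) // big1 // => j _.
  by rewrite coefZ coefXn gtn_eqF ?mulr0 // (leq_trans (ltn_ord j)).
apply: (le_integrable _ _ _ (ik k)) => //.
  by apply/measurable_EFinP; exact: measurable_horner_comp.
by move=> w _ /=; rewrite hornerXn normrX lee_fin normrX normr_id.
Qed.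

Lemma integrable_norm_pow (U : T -> R) k : measurable_fun setT U -> poly_integrable U ->
  P.-integrable setT (EFin \o (fun w => `|U w| ^+ k)).
Proof.
move=> mU iU; apply: (le_integrable _ _ _ (iU 'X^k)) => //.
  by apply/measurable_EFinP; apply: measurable_funX; exact: measurableT_comp.
by move=> w _ /=; rewrite hornerXn lee_fin !normrX normr_id.
Qed.

(** The k-th power of [u + v], for [u, v >= 0], is at most that of twice the larger one, hence at
    most [2^k (u^k + v^k)]. *)
Lemma poly_integrableD (U V : T -> R) : measurable_fun setT U -> measurable_fun setT V ->
  poly_integrable U -> poly_integrable V -> poly_integrable (fun w => U w + V w).
Proof.
move=> mU mV iU iV.
have mUV : measurable_fun setT (fun w => U w + V w) by exact: measurable_funD.
apply: poly_integrable_pow => // k.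
have i1 := integrable_norm_pow U k mU iU; have i2 := integrable_norm_pow V k mV iV.
apply: (le_integrable _ _ _ (integrableZl measurableT (2 ^+ k) (integrableD measurableT i1 i2))) => //.
  by apply/measurable_EFinP; apply: measurable_funX; exact: measurableT_comp.
move=> w _ /=; rewrite lee_fin [leLHS]ger0_norm ?exprn_ge0 // [leRHS]ger0_norm; last first.
  by rewrite mulr_ge0 ?addr_ge0 ?exprn_ge0.
rewrite mulrDr -!exprMn.
have := ler_normD (U w) (V w); have := normr_ge0 (U w); have := normr_ge0 (V w).
move: (`|U w|) (`|V w|) (`|U w + V w|) (normr_ge0 (U w + V w)) => u v z z0 v0 u0 zuv.
have [uv|vu] := leP u v.
  apply: (@le_trans _ _ ((2 * v) ^+ k)); last by rewrite lerDr exprn_ge0 // mulr_ge0.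
  by apply: lerXn2r; rewrite ?nnegrE ?mulr_ge0 //; lra.
apply: (@le_trans _ _ ((2 * u) ^+ k)); last by rewrite lerDl exprn_ge0 // mulr_ge0.
by apply: lerXn2r; rewrite ?nnegrE ?mulr_ge0 //; lra.
Qed.

Lemma poly_integrableZ (U : T -> R) c :
  poly_integrable U -> poly_integrable (fun w => U w * c).
Proof.
move=> iU q; have := iU (q \Po (c *: 'X)).
congr (_.-integrable _ _); apply/funext => w /=.
by rewrite horner_comp hornerZ hornerX mulrC.
Qed.

Lemma poly_integrable_sum n (X : 'I_n -> T -> R) (A : pred 'I_n) :
  (forall j, measurable_fun setT (X j)) -> (forall j, poly_integrable (X j)) ->
  poly_integrable (fun w => \sum_(j < n | A j) X j w).
Proof.
move=> mX iX.
suff H (s : seq 'I_n) : measurable_fun setT (fun w => \sum_(j <- s | A j) X j w) /\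
  poly_integrable (fun w => \sum_(j <- s | A j) X j w) by exact: (H _).2.
elim: s => [|i s [IH1 IH2]].
  have -> : (fun w => \sum_(j <- [::] | A j) X j w) = (fun=> 0).
    by apply/funext => w; rewrite big_nil.
  by split=> [|q]; [exact: measurable_cst|exact: finite_measure_integrable_cst].
have -> : (fun w => \sum_(j <- i :: s | A j) X j w) =
   (if A i then fun w => X i w + \sum_(j <- s | A j) X j w
    else fun w => \sum_(j <- s | A j) X j w).
  by apply/funext => w; rewrite big_cons; case: ifP.
case: ifP => _ //; split; first exact: measurable_funD.
exact: poly_integrableD.
Qed.

Lemma integrable_poly_mul (U V : T -> R) (q r : {poly R}) :
  measurable_fun setT U -> measurable_fun setT V ->
  poly_integrable U -> poly_integrable V ->
  P.-integrable setT (EFin \o (fun w => q.[U w] * r.[V w])).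
Proof.
move=> mU mV iU iV.
apply: (le_integrable _ _ _ (integrableD measurableT (iU (q * q)) (iV (r * r)))) => //.
  by apply/measurable_EFinP; apply: measurable_funM; exact: measurable_horner_comp.
move=> w _ /=; rewrite lee_fin !hornerM [leRHS]ger0_norm; last first.
  by rewrite -!expr2 addr_ge0 ?sqr_ge0.
rewrite ler_norml; move: (q.[_]) (r.[_]) => u v.
by have := sqr_ge0 (u - v); have := sqr_ge0 (u + v); rewrite !expr2; nra.
Qed.

End Integrals.

Section ConstantsNonneg.
Variables (R : realType) (J : set nat) (p : R).
Hypothesis p_ge0 : 0 <= p.

Lemma hJ_term_ge0 s k :
  (0 <= ((k ^ 2)%:R / ((k + s) ^ 2)%:R * ('C(k + s, k))%:R * p ^+ k)%:E)%E.
Proof. by rewrite lee_fin !mulr_ge0 ?invr_ge0 ?exprn_ge0. Qed.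

Hypothesis p_le1 : p <= 1.

Lemma hJ_ge0 s : (0 <= hJ J s p)%E.
Proof.
apply: mule_ge0; first by rewrite lee_fin divr_ge0 ?exprn_ge0 // subr_ge0.
by apply: nneseries_ge0 => k _ _; exact: hJ_term_ge0.
Qed.

Lemma CJ_ge0 : (0 <= CJ J p)%E.
Proof. by apply: le_trans (hJ_ge0 1) _; apply: ereal_sup_ubound; exists 1%N. Qed.

End ConstantsNonneg.

Lemma ereal_sum_affine (R : realType) n (x y : 'I_n -> \bar R) (a b : \bar R) (r q : R) :
  0 <= r -> 0 <= q -> (0 <= a)%E -> (0 <= b)%E ->
  (forall k, 0 <= x k)%E -> (forall k, 0 <= y k)%E ->
  (r%:E * \sum_k (x k * (q%:E * (a + b * y k))) =
   a * (r * q)%:E * \sum_k x k + b * (r * q)%:E * \sum_k x k * y k)%E.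
Proof.
move=> r0 q0 a0 b0 x0 y0.
have xy0 k : (0 <= x k * y k)%E by rewrite mule_ge0.
rewrite (eq_bigr (fun k => q%:E * (a * x k) + q%:E * (b * (x k * y k)))%E); last first.
  move=> k _; rewrite muleCA ge0_muleDr ?mule_ge0 // ge0_muleDr ?mule_ge0 //.
  by congr (_ * _ + _ * _)%E; [exact: muleC|exact: muleCA].
rewrite big_split /=.
rewrite -ge0_sume_distrr; last by move=> k _; rewrite mule_ge0.
rewrite -ge0_sume_distrr; last by move=> k _.
rewrite -ge0_sume_distrr; last by move=> k _; rewrite mule_ge0.
rewrite -ge0_sume_distrr; last by move=> k _.
have sx0 : (0 <= \sum_k x k)%E by exact: sume_ge0.
have sxy0 : (0 <= \sum_k x k * y k)%E by exact: sume_ge0.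
rewrite ge0_muleDr ?mule_ge0 //.
by rewrite !muleA -!EFinM ![((r * q)%:E * _)%E]muleC.
Qed.

(** * Hermite moments of the normalised sum *)

Section HermiteMomentsOfSum.
Context d (T : measurableType d) (R : realType) (P : probability T R).
Context (n : nat) (X : 'I_n -> T -> R).
Hypothesis n2 : (2 <= n)%N.
Hypothesis mX : forall j, measurable_fun setT (X j).
Hypothesis indX : mutually_independent P X.
Hypothesis iX : forall j, poly_integrable _ _ _ P (X j).

Let S w : R := (\sum_(j < n) X j w) / Num.sqrt n%:R.
Let Y k w : R := (\sum_(j < n | j != k) X j w) / Num.sqrt (n%:R - 1).
Let p : R := n%:R^-1.
Let u k := hmom _ _ R P (X k).
Let v k := hmom _ _ R P (Y k).

Let n_gt0 : 0 < n%:R :> R. Proof. by rewrite ltr0n (leq_trans _ n2). Qed.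
Let n1_gt0 : 0 < n%:R - 1 :> R. Proof. by rewrite subr_gt0 ltr1n. Qed.
Let sn_neq0 : Num.sqrt n%:R != 0 :> R. Proof. by rewrite gt_eqF // sqrtr_gt0. Qed.
Let sn1_neq0 : Num.sqrt (n%:R - 1) != 0 :> R. Proof. by rewrite gt_eqF // sqrtr_gt0. Qed.

(** For every [k], [S = c X_k + e Y_k] with [c ^+ 2 + e ^+ 2 = 1]. *)
Let c : R := (Num.sqrt n%:R)^-1.
Let e : R := Num.sqrt (n%:R - 1) / Num.sqrt n%:R.

Let c2 : c ^+ 2 = p.
Proof. by rewrite /c exprVn sqr_sqrtr // ltW. Qed.

Let e2 : e ^+ 2 = 1 - p.
Proof.
rewrite /e exprMn exprVn !sqr_sqrtr ?ltW // mulrBl mul1r divff // gt_eqF //.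
Qed.

Let mY k : measurable_fun setT (Y k).
Proof.
apply: measurable_funM => //.
have -> : (fun w => \sum_(j < n | j != k) X j w) =
    (fun w => \sum_(j < n) (if j != k then X j w else 0)).
  by apply/funext => w; rewrite big_mkcond.
apply: measurable_sum => j; case: (boolP (j != k)) => _; last exact: measurable_cst.
exact: mX.
Qed.

Let iY k : poly_integrable _ _ _ P (Y k).
Proof. by apply: poly_integrableZ; exact: poly_integrable_sum. Qed.

Lemma sum_measurable : measurable_fun setT S.
Proof. by apply: measurable_funM => //; exact: measurable_sum. Qed.

Lemma sum_poly_integrable : poly_integrable _ _ _ P S.
Proof. by apply: poly_integrableZ; exact: poly_integrable_sum. Qed.

Lemma hmom_prod k i j :
  \int[P]_w ((nherm R i).[X k w] * (nherm R j).[Y k w]) = u k i * v k j.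
Proof.
apply: (expectation_prod_independent _ _ _ P (X k) (Y k) (mX k) (mY k)
   (mutually_independent_pair _ _ _ P n X mX indX k)
   (horner (nherm R i)) (horner (nherm R j))).
- exact: measurable_poly.
- exact: measurable_poly.
- exact: iX.
- exact: iY.
- exact: integrable_poly_mul.
Qed.

Lemma hmom_sum_rel m : m.+1%:R * hmom _ _ R P S m.+1 =
  \sum_k \sum_(j < m.+2) j%:R * c ^+ j * e ^+ (m.+1 - j) * (u k j * v k (m.+1 - j)%N).
Proof.
have Sc w : S w = \sum_i c * X i w by rewrite -mulr_sumr mulrC.
rewrite /hmom -RintegralZl //; last exact: sum_poly_integrable.
have -> : \int[P]_w (m.+1%:R * (nherm R m.+1).[S w]) =
    \int[P]_w (\sum_k nherm_conv R (fun j => j%:R) c (X k w) e (Y k w) m.+1).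
  apply: eq_Rintegral => w _; rewrite Sc; apply: nherm_sum_conv.
  - by rewrite sumr_const card_ord c2 -mulr_natr mulVf // gt_eqF.
  - by move=> _; rewrite c2 e2 addrC subrK.
  - move=> k; rewrite -mulr_sumr (bigD1 k) //= mulrDr; congr (_ + _).
    by rewrite /e /Y /c; field; rewrite sn_neq0 sn1_neq0.
have it k (j : 'I_m.+2) : P.-integrable setT (EFin \o (fun w =>
    j%:R * c ^+ j * e ^+ (m.+1 - j) * ((nherm R j).[X k w] * (nherm R (m.+1 - j)).[Y k w]))).
  have := integrableZl measurableT (j%:R * c ^+ j * e ^+ (m.+1 - j))
    (integrable_poly_mul _ _ _ P (X k) (Y k) (nherm R j) (nherm R (m.+1 - j)) (mX k) (mY k) (iX k) (iY k)).
  by congr (_.-integrable _ _).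
have inner k := integrable_Rintegral_sum _ _ _ P _ (index_enum 'I_m.+2) _ (it k).
have [|_ ->] := integrable_Rintegral_sum _ _ _ P _ (index_enum 'I_n)
  (fun k w => nherm_conv R (fun j => j%:R) c (X k w) e (Y k w) m.+1).
  by move=> k; exact: (inner k).1.
apply: eq_bigr => k _; rewrite (inner k).2; apply: eq_bigr => j _.
by rewrite RintegralZl // ?hmom_prod //; exact: integrable_poly_mul.
Qed.

(* A k stands for chi^2(X_k, N), or for 0 when J contains all positive integers (in
   which case chi^2(X_k, N) is not known to be finite beforehand). *)
Variables (J : set nat) (A : 'I_n -> R).
Hypothesis uJ : forall k j, J j -> u k j = 0.
Hypothesis uA : forall k M, \sum_(1 <= j < M) j`!%:R * u k j ^+ 2 <= A k.

Let p_gt0 : 0 < p. Proof. by rewrite invr_gt0. Qed.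
Let q_ge0 : 0 <= 1 - p.
Proof. by rewrite -e2 sqr_ge0. Qed.

(** Outside [J] this is [m! / (m^2 j! s!)] times the square of [j c^j e^s], with [m = j + s]; it
    equals [p^2] times the summand of [hJ J s p]. *)
Let B j s : R := if j \in J then 0 else
  (j ^ 2)%:R / ((j + s) ^ 2)%:R * ('C(j + s, j))%:R * p ^+ j * (1 - p) ^+ s.

Let B_ge0 j s : 0 <= B j s.
Proof. by rewrite /B; case: ifP => // _; rewrite !mulr_ge0 ?exprn_ge0 // ltW. Qed.

Let beta k s : R := s`!%:R * v k s ^+ 2.

Let beta_ge0 k s : 0 <= beta k s. Proof. by rewrite mulr_ge0 ?sqr_ge0. Qed.

Let A_ge0 k : 0 <= A k.
Proof. by have := uA k 0; rewrite big_geq. Qed.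

(* Cauchy-Schwarz in k, then in j with weights j!. *)
Lemma hmom_sum_sqr_le m : m.+1`!%:R * hmom _ _ R P S m.+1 ^+ 2 <=
  n%:R * \sum_k A k * \sum_(j < m.+1) B j.+1 (m - j) * beta k (m - j)%N.
Proof.
(* Setting these coefficients to [0] on [J] leaves the sums unchanged, as [u] vanishes there, but
   removes [J] from the second factor of Cauchy-Schwarz. *)
pose y k j : R := if j.+1 \in J then 0 else j.+1%:R * c ^+ j.+1 * e ^+ (m - j) * v k (m - j)%N.
have m0 : m.+1%:R != 0 :> R by rewrite pnatr_eq0.
have hE : hmom _ _ R P S m.+1 = m.+1%:R^-1 * \sum_k \sum_(j < m.+1) u k j.+1 * y k j.
  apply: (mulfI m0); rewrite hmom_sum_rel mulrA divff // mul1r; apply: eq_bigr => k _.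
  (* The weight [j] kills the term [j = 0], so all indices shift to [j.+1]. *)
  rewrite big_ord_recl !mul0r add0r; apply: eq_bigr => j _.
  rewrite lift0 subSS /y; case: (boolP (j.+1 \in J)) => [/set_mem/(uJ k) -> |_].
    by rewrite !mul0r mulr0.
  by ring.
have main k : m.+1`!%:R / m.+1%:R ^+ 2 * (\sum_(j < m.+1) u k j.+1 * y k j) ^+ 2 <=
    A k * \sum_(j < m.+1) B j.+1 (m - j) * beta k (m - j)%N.
  have f0 i : 0 < i`!%:R :> R by rewrite ltr0n fact_gt0.
  have cs := sum_cauchy_schwarz R m.+1 (fun j => j.+1`!%:R) (fun j => u k j.+1) (fun j => y k j)
    (fun j => f0 j.+1).
  have uA' : \sum_(j < m.+1) j.+1`!%:R * u k j.+1 ^+ 2 <= A k.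
    by have := uA k m.+2; rewrite big_add1 /= big_mkord.
  have BE : \sum_(j < m.+1) B j.+1 (m - j) * beta k (m - j)%N =
      m.+1`!%:R / m.+1%:R ^+ 2 * \sum_(j < m.+1) y k j ^+ 2 / j.+1`!%:R.
    rewrite mulr_sumr; apply: eq_bigr => j _; rewrite /B /y /beta.
    case: ifP => _; first by rewrite mul0r expr0n /= mul0r mulr0.
    have jm : (j <= m)%N by rewrite -ltnS.
    have cE : (c ^+ j.+1) ^+ 2 = p ^+ j.+1 by rewrite -exprM mulnC exprM c2.
    have eE : (e ^+ (m - j)) ^+ 2 = (1 - p) ^+ (m - j) by rewrite -exprM mulnC exprM e2.
    have yE z : (j.+1%:R * c ^+ j.+1 * e ^+ (m - j) * z) ^+ 2 =
        j.+1%:R ^+ 2 * p ^+ j.+1 * (1 - p) ^+ (m - j) * z ^+ 2.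
      by rewrite -cE -eE !exprMn.
    rewrite addSn subnKC // yE !natrX.
    have -> : m.+1`!%:R = ('C(m.+1, j.+1))%:R * (j.+1`!%:R * (m - j)`!%:R) :> R.
      by rewrite -[(m - j)%N]subSS -!natrM bin_fact.
    have := gt_eqF (f0 j.+1); have := gt_eqF (f0 (m - j)%N).
    move: (j.+1`!%:R : R) ((m - j)`!%:R : R) (m.+1%:R : R) m0 => a b g g0 b0 a0.
    by field; rewrite g0 a0.
  rewrite BE [leRHS]mulrCA; apply: ler_wpM2l; first by rewrite divr_ge0 ?exprn_ge0.
  apply: le_trans cs _; apply: ler_wpM2r uA'.
  by apply: sumr_ge0 => j _; rewrite divr_ge0 ?sqr_ge0.
rewrite hE exprMn exprVn mulrA.
apply: (@le_trans _ _ (m.+1`!%:R / m.+1%:R ^+ 2 *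
    (n%:R * \sum_k (\sum_(j < m.+1) u k j.+1 * y k j) ^+ 2))).
  by apply: ler_wpM2l (sqr_sum_le _ _ _); rewrite divr_ge0 ?exprn_ge0.
rewrite mulrCA; apply: ler_wpM2l; first exact: ltW.
by rewrite mulr_sumr; apply: ler_sum => k _; exact: main.
Qed.

(** Summation over [m] covers a triangle in [(j, s)], which is enlarged to a square by
    nonnegativity. *)
Lemma hmom_sum_bound M : \sum_(1 <= m < M.+1) m`!%:R * hmom _ _ R P S m ^+ 2 <=
  n%:R * \sum_k A k * \sum_(s < M) beta k s * \sum_(j < M) B j.+1 s.
Proof.
rewrite big_add1 /= big_mkord.
apply: le_trans (ler_sum _ (fun (m : 'I_M) _ => hmom_sum_sqr_le m)) _.
rewrite -mulr_sumr ler_wpM2l // exchange_big /=; apply: ler_sum => k _.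
rewrite -mulr_sumr ler_wpM2l //.
rewrite (sum_antidiagonal _ M (fun j s => B j.+1 s * beta k s)).
under [X in _ <= X]eq_bigr => s _ do rewrite mulr_sumr.
rewrite [X in _ <= X]exchange_big /=; apply: ler_sum => j _.
rewrite (big_ord_widen M (fun s => B j.+1 s * beta k s)) ?leq_subr //.
rewrite big_mkcond /=; apply: ler_sum => s _; rewrite mulrC.
by case: ifP => _ //; rewrite mulr_ge0.
Qed.

Let p_le1 : p <= 1. Proof. by rewrite -subr_ge0. Qed.

Let hJp_ge0 s : (0 <= hJ J s p)%E.
Proof. by apply: hJ_ge0 => //; exact: ltW. Qed.

Let CJp_ge0 : (0 <= CJ J p)%E.
Proof. by apply: CJ_ge0 => //; exact: ltW. Qed.

Lemma sum_B_le_hJ M s : ((\sum_(j < M) B j.+1 s)%:E <= (p ^+ 2)%:E * hJ J s p)%E.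
Proof.
rewrite /hJ muleA -EFinM [p ^+ 2 * _]mulrCA divff ?expf_neq0 ?gt_eqF // mulr1.
apply: (@le_trans _ _ (((1 - p) ^+ s)%:E * \sum_(1 <= k < M.+1 | k \notin J)
    ((k ^ 2)%:R / ((k + s) ^ 2)%:R * ('C(k + s, k))%:R * p ^+ k)%:E)%E); last first.
  apply: lee_wpmul2l; first by rewrite lee_fin exprn_ge0.
  by apply: nneseries_lim_ge => k _ _; exact: (hJ_term_ge0 _ _ (ltW p_gt0)).
rewrite sumEFin -EFinM lee_fin big_add1 /= big_mkord [X in _ <= _ * X]big_mkcond mulr_sumr /=.
apply: ler_sum => j _; rewrite /B; case: (boolP (_ \in J)) => _ /=; first by rewrite mulr0.
by rewrite mulrC.
Qed.

(** At [s = 0] the quotient and the binomial coefficient are [1], so [hJ] becomes the coefficient of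
    the first sum in the theorem; [CJ] only ranges over [s > 0]. *)
Lemma hJ0E : hJ J 0 p = (\sum_(1 <= j <oo | j \notin J) (n%:R ^+ 2 / n%:R ^+ j : R)%:E)%E.
Proof.
rewrite /hJ expr0 -nneseriesZl; last by move=> k _; exact: (hJ_term_ge0 _ _ (ltW p_gt0)).
congr (limn _); apply/funext => M.
rewrite big_nat_cond [RHS]big_nat_cond; apply: eq_bigr => k /andP[/andP[k1 _] _].
rewrite addn0 binn mulr1 -EFinM; congr EFin.
have k0 : (k ^ 2)%:R != 0 :> R by rewrite pnatr_eq0 expn_eq0 andbT gtn_eqF.
by rewrite divff // !mul1r /p !exprVn invrK.
Qed.

(** The term [s = 0] has [beta = 1] and gives [hJ J 0 p]. For [s > 0] the inner sums are bounded
    through [CJ J p], and the remaining sum of [beta] by Bessel's inequality for [Y k]. *)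
Lemma sum_beta_B_le M k :
  ((\sum_(s < M) beta k s * \sum_(j < M) B j.+1 s)%:E <=
   (p ^+ 2)%:E * (hJ J 0 p + CJ J p * chi2 P (Y k)))%E.
Proof.
case: M => [|M].
  rewrite big_ord0 mule_ge0 ?lee_fin ?sqr_ge0 // adde_ge0 // mule_ge0 //.
  exact: chi2_ge0.
rewrite big_ord_recl EFinD ge0_muleDr //; last by apply: mule_ge0 => //; exact: chi2_ge0.
have -> : beta k 0 = 1.
  rewrite /beta /v mul1r (hmom0 _ _ R P (Y k)) expr1n //.
rewrite mul1r; apply: leeD; first exact: sum_B_le_hJ.
apply: (@le_trans _ _ (\sum_(i < M) ((beta k i.+1)%:E * ((p ^+ 2)%:E * CJ J p)))%E).
  rewrite -sumEFin; apply: lee_sum => i _; rewrite lift0 EFinM.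
  apply: lee_wpmul2l; first by rewrite lee_fin.
  apply: le_trans (sum_B_le_hJ _ _) _; apply: lee_wpmul2l; first by rewrite lee_fin sqr_ge0.
  by apply: ereal_sup_ubound; exists i.+1.
rewrite -ge0_sume_distrl; last by move=> i _; rewrite lee_fin.
rewrite [X in (_ <= X)%E]muleA [X in (_ <= X)%E]muleC; apply: lee_wpmul2r; first by rewrite mule_ge0 // lee_fin sqr_ge0.
have := chi2_bessel _ _ R P (Y k) (mY k) M.+1.
by rewrite big_add1 /= big_mkord sumEFin.
Qed.

Lemma chi2_sum_le : (forall k, (A k)%:E <= chi2 P (X k))%E ->
  (chi2 P S <= hJ J 0 p * p%:E * (\sum_(k < n) chi2 P (X k))
    + CJ J p * p%:E * (\sum_(k < n) chi2 P (X k) * chi2 P (Y k)))%E.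
Proof.
move=> Achi; set RHS := (X in (_ <= X)%E).
have chi0 := chi2_ge0.
have bound M : ((\sum_(1 <= m < M.+1) m`!%:R * hmom _ _ R P S m ^+ 2)%:E <= RHS)%E.
  apply: (@le_trans _ _ (n%:R%:E * \sum_k (chi2 P (X k) *
      ((p ^+ 2)%:E * (hJ J 0 p + CJ J p * chi2 P (Y k)))))%E).
    apply: (@le_trans _ _ _ _ _ (_ : (_ <= (n%:R * _)%:E)%E)).
      by rewrite lee_fin; exact: hmom_sum_bound.
    rewrite EFinM -sumEFin; apply: lee_wpmul2l; first by rewrite lee_fin ltW.
    apply: lee_sum => k _; rewrite EFinM.
    apply: lee_pmul => //; first by rewrite lee_fin.
    + by rewrite lee_fin sumr_ge0 // => s _; rewrite mulr_ge0 // sumr_ge0.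
    + exact: sum_beta_B_le.
  have np2 : n%:R * p ^+ 2 = p by rewrite expr2 mulrA divff ?mul1r // gt_eqF.
  rewrite (ereal_sum_affine _ n _ _ _ _ _ _ (ltW n_gt0) (sqr_ge0 p) (hJp_ge0 0) CJp_ge0) ?np2 //.
have RHS0 : (0 <= RHS)%E by apply: le_trans (bound 0%N); rewrite big_geq.
(* The bound in [chi2_le] is a real number; a right-hand side equal to [+oo] is trivial, and [-oo]
   is excluded by nonnegativity. *)
move: RHS0 bound; case: RHS => [r r0 bound|_ _|//]; last exact: leey.
apply: (chi2_le _ _ R P S sum_measurable r sum_poly_integrable) => -[|M].
  by rewrite big_geq // -lee_fin.
by rewrite -lee_fin.
Qed.

End HermiteMomentsOfSum.

Theorem theorem6 (d : measure_display) (T : measurableType d) (R : realType)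
  (P : probability T R) (n : nat) (X : 'I_n -> T -> R) (J : set nat) :
  (2 <= n)%N ->
  (forall j, measurable_fun setT (X j)) ->
  mutually_independent P X ->
  (forall j, ('E_P[X j] = 0)%E) ->
  (forall j, ('E_P[fun w => (X j w ^+ 2)%R] = 1)%E) ->
  J `<=` [set k | (0 < k)%N] ->
  (forall k j, J k ->
     P.-integrable setT (fun w => (hermite k (X j w))%:E) /\
     ('E_P[fun w => (hermite k (X j w))%R] = 0)%E) ->
  (chi2 P (fun w => ((\sum_(j < n) X j w) / Num.sqrt n%:R)%R)
   <=
   (\sum_(1 <= j <oo | j \notin J) ((n%:R ^+ 2 / n%:R ^+ j : R)%R%:E))
     * (n%:R^-1)%R%:E * (\sum_(k < n) chi2 P (X k))
   + CJ J (n%:R^-1)%R * (n%:R^-1)%R%:E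
     * (\sum_(k < n) chi2 P (X k)
          * chi2 P (fun w => ((\sum_(j < n | j != k) X j w)
                             / Num.sqrt (n%:R - 1))%R)))%E.
Proof.
move=> n2 mX indX _ _ Jpos JX.
have chi0 (U : T -> R) : (0 <= chi2 P U)%E by exact: chi2_ge0.
have hE k (U : T -> R) : (fun w => hermite k (U w)) = (fun w => (hermp R k).[U w]).
  by apply/funext => w; rewrite hermiteE.
have uJ k j : J j -> hmom _ _ R P (X k) j = 0.
  move=> /(JX j k)[iH]; rewrite hE unlock => EH.
  have iH' : P.-integrable setT (EFin \o (fun w => (hermp R j).[X k w])).
    by move: iH; congr (_.-integrable _ _); apply/funext => w; rewrite /= hermiteE.
  rewrite /hmom.
  transitivity (\int[P]_w (j`!%:R^-1 * (hermp R j).[X k w])).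
    by apply: eq_Rintegral => w _; rewrite /nherm hornerZ.
  by rewrite RintegralZl // /Rintegral EH mulr0.
have p0 : 0 < n%:R^-1 :> R by rewrite invr_gt0 ltr0n (leq_trans _ n2).
have n0 : 0 < n%:R :> R by rewrite ltr0n (leq_trans _ n2).
have hJ0 := hJ0E R n n2 J; rewrite -hJ0.
have finish (A : 'I_n -> R) : (forall k, poly_integrable _ _ _ P (X k)) ->
    (forall k M, \sum_(1 <= j < M) j`!%:R * hmom _ _ R P (X k) j ^+ 2 <= A k) ->
    (forall k, (A k)%:E <= chi2 P (X k))%E -> _ :=
  fun iX => chi2_sum_le _ _ R P n X n2 mX indX iX J A uJ.
(* If [J] contains every positive integer, all Hermite moments of the [X k] vanish and [A = 0]
   works; integrability of polynomials then comes from [JX]. *)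
have [[j0 [j0_gt0 j0J]]|allJ] := pselect (exists j, (0 < j)%N /\ ~ J j); last first.
  have {}allJ j : (0 < j)%N -> J j by move=> j0; apply: contrapT => nJ; apply: allJ; exists j.
  apply: (finish (fun=> 0)) => [k|k M|k]; last exact: chi0.
    apply: (poly_integrable_spanned _ _ _ P (X k) (hermp R) (hermp_span R)) => -[|j].
      have -> : (fun w => (hermp R 0).[X k w]) = (fun=> 1).
        by apply/funext => w; rewrite hornerC.
      exact: finite_measure_integrable_cst.
    have [+ _] := JX j.+1 k (allJ j.+1 isT).
    by congr (_.-integrable _ _); apply/funext => w; rewrite /= hermiteE.
  rewrite big_nat_cond big1 // => j /andP[/andP[j1 _] _].
  by rewrite uJ ?expr0n ?mulr0 //; exact: allJ.
(* If every chi^2 of an [X k] is finite, it is itself taken as [A k], and it gives the integrability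
   of polynomials. *)
have [[k0 k0oo]|nooo] := pselect (exists k, chi2 P (X k) = +oo%E); last first.
  have fin k : (chi2 P (X k) < +oo)%E.
    by rewrite ltey; apply/eqP => koo; apply: nooo; exists k.
  have finE k : (fine (chi2 P (X k)))%:E = chi2 P (X k).
    by rewrite fineK // ge0_fin_numE.
  apply: (finish (fun k => fine (chi2 P (X k)))) => [k q|k M|k].
  - exact: (chi2_lty_integrable_horner _ _ R P (X k) (mX k) (fin k) q).
  - by rewrite -lee_fin finE; exact: chi2_bessel.
  - by rewrite finE.
(* Some chi^2 of an [X k] is infinite here. The index [j0] outside [J] makes the coefficient of the
   first sum positive, so the right-hand side is [+oo]. *)
have L_gt0 : (0 < hJ J 0 n%:R^-1 :> \bar R)%E.
  rewrite hJ0; apply: (@lt_le_trans _ _ (n%:R ^+ 2 / n%:R ^+ j0 : R)%:E).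
    by rewrite lte_fin divr_gt0 // exprn_gt0.
  have j0J' : j0 \notin J by apply/negP => /set_mem.
  apply: (@le_trans _ _ (\sum_(1 <= j < j0.+1 | j \notin J) (n%:R ^+ 2 / n%:R ^+ j : R)%:E)%E).
    rewrite big_mkcond big_nat_recr //= j0J' leeDr // sume_ge0 // => j _.
    by case: ifP => _ //; rewrite lee_fin divr_ge0 // exprn_ge0 // ltW.
  by apply: nneseries_lim_ge => j _ _; rewrite lee_fin divr_ge0 // exprn_ge0 // ltW.
have sumoo : (\sum_(k < n) chi2 P (X k) = +oo)%E.
  rewrite (bigD1 k0) //= k0oo addye // gt_eqF // (lt_le_trans ltNy0) //.
  exact: sume_ge0.
have CJ0 : (0 <= CJ J n%:R^-1 :> \bar R)%E 
  by apply: CJ_ge0; rewrite ?invf_le1 ?ler1n ?(leq_trans _ n2) // ltW.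
rewrite sumoo gt0_muley; last by rewrite mule_gt0 // lte_fin.
rewrite addye ?leey // gt_eqF // (lt_le_trans ltNy0) // mule_ge0 //.
  by rewrite mule_ge0 // lee_fin ltW.
by apply: sume_ge0 => k _; rewrite mule_ge0.
Qed.
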